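(* Let $(\mathcal{S},\mathcal{A},p,r,\gamma)$ be a discounted MDP with finite action space $\mathcal{A}$, bounded reward $r$ and discount factor $\gamma\in[0,1)$, regularized by the policy entropy with temperature $\eta>0$. Let $\pi_0$ be any initial policy with corresponding soft action-value function $Q^{\pi_0}$, and let $(\pi_k)_{k\ge 0}$ be the sequence of policies produced from $\pi_0$ by soft policy iteration over the softmax policy class $\Pi$, i.e. by alternating soft policy evaluation and soft policy improvement. Then $(\pi_k)$ converges pointwise to a policy $\pi^\star$ and $(Q^{\pi_k})$ converges pointwise to $Q^{\pi^\star}$, and these limits satisfy, for all $(s,a)\in\mathcal{S}\times\mathcal{A}$, $$Q^{\pi^\star}(s,a)=\tilde Q^\star(s,a)\qquad\text{and}\qquad \pi^\star(a\mid s)=\tilde\pi^\star(a\mid s).$$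
   Context: Setting. $\mathcal{S}$ is a (measurable) state space, $\mathcal{A}$ a nonempty finite action set, $p(\cdot\mid s,a)$ a transition probability kernel on $\mathcal{S}$, $r:\mathcal{S}\times\mathcal{A}\to\mathbb{R}$ a bounded (measurable) reward, $\gamma\in[0,1)$, and $\eta>0$ a temperature. A policy $\pi$ is a stationary stochastic policy: $\pi(\cdot\mid s)$ is a probability distribution on $\mathcal{A}$ for each $s$ (measurable in $s$). Its entropy at $s$ is $\mathcal{H}(\pi(\cdot\mid s))=-\sum_{a}\pi(a\mid s)\log\pi(a\mid s)$, with $0\log 0=0$. Optimal regularized quantities. For a policy $\pi$, $$\tilde V^\pi(s)=\mathbb{E}\Bigl[\sum_{l=0}^\infty\gamma^l\bigl(r(s_l,a_l)+\eta\,\mathcal{H}(\pi(\cdot\mid s_l))\bigr)\Bigm| s_0=s\Bigr],\quad a_l\sim\pi(\cdot\mid s_l),\ s_{l+1}\sim p(\cdot\mid s_l,a_l).$$ The optimal regularized value function is $\tilde V^\star(s)=\sup_\pi\tilde V^\pi(s)$. Define $$\tilde Q^\star(s,a)=r(s,a)+\gamma\,\mathbb{E}_{s'\sim p(\cdot\mid s,a)}[\tilde V^\star(s')].$$ The optimal regularized policy is $$\tilde\pi^\star(a\mid s)=\frac{\exp(\tilde Q^\star(s,a)/\eta)}{\sum_{b\in\mathcal{A}}\exp(\tilde Q^\star(s,b)/\eta)}.$$ Soft policy evaluation. For a policy $\pi$, the soft Bellman operator acts on bounded functions $Q:\mathcal{S}\times\mathcal{A}\to\mathbb{R}$ by $$\mathcal{T}^\pi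 Q(s,a)=r(s,a)+\gamma\,\mathbb{E}_{s'\sim p(\cdot\mid s,a)}[V(s')],\qquad V(s)=\sum_{a\in\mathcal{A}}\pi(a\mid s)\bigl[Q(s,a)-\eta\log\pi(a\mid s)\bigr].$$ It is a $\gamma$-contraction in the sup norm. Its unique bounded fixed point is the soft action-value function $Q^\pi$; soft policy evaluation of $\pi$ returns $Q^\pi$. Softmax policy class. $\Pi$ is the set of all policies of the form $\pi(a\mid s)=\exp(f(s,a))/\sum_{b\in\mathcal{A}}\exp(f(s,b))$ with $f:\mathcal{S}\times\mathcal{A}\to\mathbb{R}$ (measurable). Soft policy improvement. Given $\pi_k$, the next policy is, for every $s\in\mathcal{S}$, $$\pi_{k+1}(\cdot\mid s)=\arg\min_{\pi'\in\Pi}D_{\mathrm{KL}}\Bigl(\pi'(\cdot\mid s)\,\Big\|\,\frac{\exp(Q^{\pi_k}(s,\cdot)/\eta)}{\sum_{b\in\mathcal{A}}\exp(Q^{\pi_k}(s,b)/\eta)}\Bigr),$$ equivalently $\pi_{k+1}(a\mid s)=\exp(Q^{\pi_k}(s,a)/\eta)/\sum_{b}\exp(Q^{\pi_k}(s,b)/\eta)$. Soft policy iteration alternates soft policy evaluation and soft policy improvement. *)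

(* Defs.v *)
From HB Require Import structures.
From mathcomp Require Import all_boot all_order all_algebra.
From mathcomp Require Import all_classical all_reals all_analysis.

Set Implicit Arguments.
Unset Strict Implicit.
Unset Printing Implicit Defensive.

Import Order.TTheory GRing.Theory Num.Theory.
Import numFieldNormedType.Exports.
Local Open Scope classical_set_scope.
Local Open Scope ring_scope.

(* The finite set A carries its discrete sigma-algebra: a function of (s, a) is
   measurable iff all its sections s |-> f s a are, and a transition kernel on
   S * A is an A-indexed family of kernels on S. *)
Record mdp (d : measure_display) (S : measurableType d) (A : finType)
    (R : realType) := Mdp {
  trans : A -> R.-pker S ~> S;
  reward : S -> A -> R;
  discount : R;
  reward_measurable : forall a, measurable_fun setT (fun s => reward s a);
  reward_bounded : exists C, forall s a, `|reward s a| <= C;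
  discount_ge0 : 0 <= discount;
  discount_lt1 : discount < 1 }.

Section EntropyRegularizedMDP.
Context {d : measure_display} {S : measurableType d} {A : finType}
  {R : realType}.
Implicit Types (M : mdp S A R) (eta : R) (pi f Q : S -> A -> R).

Definition policy pi : Prop :=
  [/\ forall a, measurable_fun setT (fun s => pi s a),
      forall s a, 0 <= pi s a &
      forall s, \sum_(a in A) pi s a = 1].

(* The convention 0 log 0 = 0 is automatic since 0 * ln 0 = 0. *)
Definition entropy (q : A -> R) : R := - \sum_(a in A) q a * ln (q a).

Definition KL (q q' : A -> R) : R := \sum_(a in A) q a * ln (q a / q' a).

Definition softmax f : S -> A -> R :=
  fun s a => expR (f s a) / \sum_(b in A) expR (f s b).

Definition softmax_class : set (S -> A -> R) :=
  [set pi | exists f, (forall a, measurable_fun setT (fun s => f s a)) /\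
                      forall s a, pi s a = softmax f s a].

Section Trajectories.
Context {d' : measure_display} {Omega : measurableType d'}.
Variables (st : nat -> Omega -> S) (ac : nat -> Omega -> A).

(* The events determined by s_0, ..., s_m and by a_0, ..., a_(n-1). *)
Definition history (m n : nat) : set (set Omega) :=
  <<s [set E | (exists2 i, (i <= m)%N & exists2 B, measurable B &
                  E = st i @^-1` B) \/
               (exists2 i, (i < n)%N & exists a, E = ac i @^-1` [set a])] >>.

(* Under P, (s_0, a_0, s_1, a_1, ...) starts at s0, and, conditionally on the
   past, a_n has law pi(. | s_n) and s_(n+1) has law p(. | s_n, a_n). *)
Definition controlled_process M pi (s0 : S) (P : probability Omega R) : Prop :=
  [/\ forall n, measurable_fun setT (st n),
      forall n a, measurable (ac n @^-1` [set a]),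
      forall B, measurable B -> P (st 0%N @^-1` B) = \d_s0 B,
      forall n a H, history n n H ->
        (P (H `&` ac n @^-1` [set a]) = \int[P]_(w in H) (pi (st n w) a)%:E)%E &
      forall n B H, measurable B -> history n n.+1 H ->
        (P (H `&` st n.+1 @^-1` B) =
          \int[P]_(w in H) trans M (ac n w) (st n w) B)%E].

Definition regularized_return M eta pi (w : Omega) : R :=
  limn (series (fun l => discount M ^+ l *
    (reward M (st l w) (ac l w) + eta * entropy (pi (st l w))))).

End Trajectories.

(* Any realization of the process may be used: the expectation of the return
   depends only on the law of the process, which M, pi and s determine. *)
Definition is_regularized_value M eta pi (s : S) (v : R) : Prop :=
  exists (d' : measure_display) (Omega : measurableType d')
    (P : probability Omega R) (st : nat -> Omega -> S) (ac : nat -> Omega -> A),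
    controlled_process st ac M pi s P /\
    ('E_P[regularized_return st ac M eta pi] = v%:E)%E.

Definition regularized_value M eta pi (s : S) : R :=
  xget 0 [set v | is_regularized_value M eta pi s v].

Definition opt_value M eta (s : S) : R :=
  sup [set regularized_value M eta pi s | pi in policy].

Definition opt_qvalue M eta : S -> A -> R :=
  fun s a => reward M s a +
    discount M * \int[trans M a s]_s' opt_value M eta s'.

Definition opt_policy M eta : S -> A -> R :=
  softmax (fun s a => opt_qvalue M eta s a / eta).

Definition soft_bellman M eta pi Q : S -> A -> R :=
  fun s a => reward M s a + discount M * \int[trans M a s]_s'
    \sum_(b in A) pi s' b * (Q s' b - eta * ln (pi s' b)).

Definition bounded_qfun Q : Prop :=
  (forall a, measurable_fun setT (fun s => Q s a)) /\
  exists C, forall s a, `|Q s a| <= C.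

(* The bounded (measurable) fixed point of the soft Bellman operator. *)
Definition soft_qvalue M eta pi : S -> A -> R :=
  xget (fun _ _ => 0)
    [set Q | bounded_qfun Q /\ soft_bellman M eta pi Q = Q].

Definition soft_improvement eta Q pi' : Prop :=
  softmax_class pi' /\
  forall s rho, softmax_class rho ->
    KL (pi' s) (softmax (fun s a => Q s a / eta) s) <=
    KL (rho s) (softmax (fun s a => Q s a / eta) s).

Definition soft_policy_iteration M eta (pi : nat -> S -> A -> R) : Prop :=
  forall k, soft_improvement eta (soft_qvalue M eta (pi k)) (pi k.+1).

End EntropyRegularizedMDP.

(* Main.v *)
(* The operator T Q = r + gamma E[eta log sum_b exp(Q(., b) / eta)] is a monotone
   gamma-contraction, with bounded fixed point Q*. By Gibbs' inequality it
   dominates the soft Bellman operator of every policy, with equality at Q for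
   the policy softmax(Q / eta). Comparing sub- and supersolutions gives
   Q^pi <= Q* for every policy, Q^pi = Q* for pi = softmax(Q* / eta), and
   T Q^pi_k <= Q^pi_(k+1) <= Q*, so that Q* - Q^pi_k decreases geometrically.

   Telescoping E[V(s_n)] = E[r + eta H] + gamma E[V(s_(n+1))] identifies the
   expected return of any realization of the process with the value derived from
   Q^pi. As the value of a policy is 0 by default when the process has no
   realization, one has to be constructed for every policy; the state space being
   arbitrary, this is the Ionescu-Tulcea theorem. *)
Require Import Defs.
From HB Require Import structures.
From mathcomp Require Import all_boot all_order all_algebra.
From mathcomp Require Import all_classical all_reals all_analysis.
From mathcomp Require Import measurable_realfun ring lra.

Set Implicit Arguments.
Unset Strict Implicit.
Unset Printing Implicit Defensive.

Import Order.TTheory GRing.Theory Num.Theory.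
Import numFieldNormedType.Exports.
Local Open Scope classical_set_scope.
Local Open Scope ring_scope.

(** The laws of the process are given on events, while telescoping needs them on bounded functions.
    The passage is always the same: against a mixture of measures, a nonnegative function is
    integrated by integrating twice, and a bounded function becomes nonnegative once a bound is
    added to it. The same fact computes integrals against the laws of the construction. The state
    space has no topology, so sigma-additivity of the constructed law cannot come from compactness:
    a point common to nested cylinders is built by choosing its coordinates one at a time. Recording
    each action together with the state it leads to turns the controlled process into a homogeneous
    Markov chain, so that a single kernel suffices. An improved policy is only known to minimize a
    divergence over the softmax class; the equality case of Gibbs' inequality identifies it with a
    softmax. *)

Section Mixture.
Context {d d' : measure_display} {Y : measurableType d} {Z : measurableType d'}
  {R : realType}.
Import HBNNSimple.
Local Open Scope ereal_scope.

(** On simple functions both sides are finite combinations of the hypothesis on level sets, and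
    monotone convergence does the rest. [k] is a bare family rather than a bundled kernel, so that
    pushforwards and weighted Dirac masses fit directly. *)
Lemma ge0_integral_mixture (mu : {measure set Y -> \bar R})
    (nu : {measure set Z -> \bar R}) (k : Y -> {measure set Z -> \bar R})
    (f : Z -> \bar R) :
  (forall U, measurable U -> measurable_fun setT (k ^~ U)) ->
  (forall U, measurable U -> nu U = \int[mu]_y k y U) ->
  (forall z, 0 <= f z) -> measurable_fun setT f ->
  \int[nu]_z f z = \int[mu]_y \int[k y]_z f z.
Proof.
move=> mk nuE f0 mf.
pose f_ := nnsfun_approx measurableT mf.
have simple (m : {measure set Z -> \bar R}) n : \int[m]_z (f_ n z)%:E =
    \sum_(r \in range (f_ n)) (r%:E * m (f_ n @^-1` [set r])).
  under eq_integral do rewrite fimfunE -fsumEFin//.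
  rewrite ge0_integral_fsum//; last 2 first.
    by move=> r; exact/measurable_EFinP/measurableT_comp.
    by move=> r z _; rewrite EFinM nnfun_muleindic_ge0.
  apply: eq_fsbigr => r _.
  under eq_integral do rewrite EFinM.
  rewrite (integralZl_indic _ (fun r => f_ n @^-1` [set r]))//; last first.
    by move=> r0; rewrite preimage_nnfun0.
  by rewrite integral_indic// setIT.
have approx (m : {measure set Z -> \bar R}) :
    \int[m]_z (f_ n z)%:E @[n --> \oo] --> \int[m]_z f z.
  have -> : \int[m]_z f z = \int[m]_z limn (fun n => (f_ n z)%:E).
    by apply: eq_integral => z _; apply/esym/cvg_lim => //; exact: cvg_nnsfun_approx.
  apply: cvg_monotone_convergence => //.
  - by move=> n; exact/measurable_EFinP.
  - by move=> n z _; rewrite lee_fin.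
  - by move=> z _ a b ab; rewrite lee_fin; exact/lefP/nd_nnsfun_approx.
have mint n : measurable_fun setT (fun y => \int[k y]_z (f_ n z)%:E).
  apply: measurable_fun_integral_kernel => //.
  - by move=> z; rewrite lee_fin.
  - exact/measurable_EFinP.
have int_ge0 n y : 0 <= \int[k y]_z (f_ n z)%:E.
  by apply: integral_ge0 => z _; rewrite lee_fin.
have fE n : \int[nu]_z (f_ n z)%:E = \int[mu]_y \int[k y]_z (f_ n z)%:E.
  rewrite simple; under [RHS]eq_integral do rewrite simple.
  rewrite ge0_integral_fsum//.
  - apply: eq_fsbigr => r _; rewrite nuE//.
    have [r0|r0] := leP 0%R r; first by rewrite ge0_integralZl//; exact: mk.
    rewrite preimage_nnfun0// !integral0_eq ?mule0// => y _.
    by rewrite measure0 ?mule0.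
  - by move=> r; apply: measurable_funeM; exact: mk.
  - move=> r y _; apply: (mulemu_ge0 (fun r => f_ n @^-1` [set r])).
    exact: preimage_nnfun0.
rewrite -(cvg_lim _ (approx nu))//; under eq_fun do rewrite fE.
under [RHS]eq_integral do rewrite -(cvg_lim _ (approx _))//.
rewrite monotone_convergence// => y _ a b ab.
apply: ge0_le_integral => //.
- by move=> z _; rewrite lee_fin.
- exact/measurable_EFinP.
- exact/measurable_EFinP.
- by move=> z _; rewrite lee_fin; exact/lefP/nd_nnsfun_approx.
Qed.

End Mixture.

Lemma bounded_integrable {d : measure_display} {T : measurableType d}
    {R : realType} (mu : {measure set T -> \bar R}) (f : T -> R) (C : R) :
  mu setT = 1%E -> measurable_fun setT f -> (forall x, `|f x| <= C) ->
  mu.-integrable setT (EFin \o f).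
Proof.
move=> mu1 mf fC; apply/integrableP; split; first exact/measurable_EFinP.
apply: (@le_lt_trans _ _ (\int[mu]_x (C%:E))%E); last first.
  by rewrite integral_cst// mu1 mule1 ltry.
apply: ge0_le_integral => //.
- by apply: measurableT_comp => //; exact/measurable_EFinP.
- by move=> x _; rewrite lee_fin.
Qed.

(** * The Ionescu-Tulcea theorem for a Markov kernel *)

Section TrajectorySpace.
Context {d : measure_display} {T : measurableType d}.

Definition coordinate_events : set (set (nat -> T)) :=
  [set E | exists i, exists2 B, measurable B & E = (fun w => w i) @^-1` B].

Definition trajectory : Type := g_sigma_algebraType coordinate_events.
HB.instance Definition _ := Measurable.on trajectory.

Lemma measurable_coordinate i :
  measurable_fun [set: trajectory] (fun w : trajectory => w i).
Proof.
by move=> _ B mB; rewrite setTI; apply: sub_sigma_algebra; exists i, B.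
Qed.

Lemma measurable_fun_trajectory {d' : measure_display} {Y : measurableType d'}
    (f : Y -> trajectory) :
  (forall i, measurable_fun setT (fun y => f y i)) -> measurable_fun setT f.
Proof.
move=> mf; apply: (@measurability _ _ _ trajectory setT f coordinate_events) => //.
move=> _ [_ [i [B mB ->]] <-]; exact: mf.
Qed.

Definition tcons (x : T) (w : trajectory) : trajectory :=
  fun n => if n is m.+1 then w m else x.

Lemma measurable_tcons :
  measurable_fun setT (fun p : T * trajectory => tcons p.1 p.2).
Proof.
apply: measurable_fun_trajectory => -[|i] /=; first exact: measurable_fst.
exact: (measurableT_comp (measurable_coordinate i) measurable_snd).
Qed.

Lemma measurable_tcons1 x : measurable_fun setT (tcons x).
Proof.
by apply: measurable_fun_trajectory => -[|i] //=; exact: measurable_coordinate.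
Qed.

(** With [V := Prop] this also applies to sets of trajectories. *)
Definition depends_on {V : Type} n (f : trajectory -> V) :=
  forall w w', (forall i, (i < n)%N -> w i = w' i) -> f w = f w'.

Lemma depends_onW {V : Type} m n (f : trajectory -> V) :
  (m <= n)%N -> depends_on m f -> depends_on n f.
Proof. by move=> mn fm w w' ww'; apply: fm => i /leq_trans => /(_ _ mn)/ww'. Qed.

Lemma depends_on_tcons {V : Type} n (f : trajectory -> V) x :
  depends_on n.+1 f -> depends_on n (f \o tcons x).
Proof. by move=> fn w w' ww'; apply: fn => -[|i] //= /ww'. Qed.

Lemma depends_on0 {V : Type} (f : trajectory -> V) w w' :
  depends_on 0 f -> f w = f w'.
Proof. by apply. Qed.

Definition cylinder n : set (set trajectory) :=
  [set C | measurable C /\ depends_on n C].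

Lemma cylinderW m n : (m <= n)%N -> cylinder m `<=` cylinder n.
Proof. by move=> mn C [mC Cm]; split => //; exact: depends_onW Cm. Qed.

Lemma cylinder_tcons n C x : cylinder n.+1 C -> cylinder n (tcons x @^-1` C).
Proof.
move=> [mC Cn]; split; last by move=> w w'; exact: (@depends_on_tcons _ n C x Cn).
by rewrite -[X in measurable X]setTI; exact: measurable_tcons1.
Qed.

(** Serves for agreement on the first n coordinates, and for agreement on these and on the action of
    the next one, which is what a history ending with an action knows. *)
Lemma invariant_sigma_algebra (E : trajectory -> trajectory -> Prop) :
  sigma_algebra setT
    [set C | measurable C /\ forall w w', E w w' -> C w = C w'].
Proof.
split => [|C [mC CE]|F FE].
- by split.
- rewrite setTD; split; first exact: measurableC.
  by move=> w w' /CE ww'; rewrite /setC /mkset ww'.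
- split; first by apply: bigcupT_measurable => i; have [] := FE i.
  move=> w w' ww'; apply/propext; split=> -[i _ Fi]; exists i => //;
  have [_ /(_ _ _ ww') eqF] := FE i; first by rewrite -eqF.
  by rewrite eqF.
Qed.

Lemma cylinder_sigma_algebra n : sigma_algebra setT (cylinder n).
Proof.
exact: (invariant_sigma_algebra (fun w w' => forall i, (i < n)%N -> w i = w' i)).
Qed.

Definition is_cylinder : set (set trajectory) := [set C | exists n, cylinder n C].

Lemma is_cylinder0 : is_cylinder set0.
Proof. by exists 0%N. Qed.

Lemma is_cylinderU : setU_closed is_cylinder.
Proof.
move=> A B [m Am] [n Bn]; exists (maxn m n).
have [mA An] := cylinderW (leq_maxl m n) Am.
have [mB Bn'] := cylinderW (leq_maxr m n) Bn.
split; first exact: measurableU.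
by move=> w w' ww'; rewrite /setU /mkset (An _ _ ww') (Bn' _ _ ww').
Qed.

Lemma is_cylinderC : setC_closed is_cylinder.
Proof.
move=> A [n An]; exists n; rewrite -setTD.
by have [_ + _] := cylinder_sigma_algebra n; apply.
Qed.

Lemma is_cylinder_coordinate i B :
  measurable B -> is_cylinder ((fun w => w i) @^-1` B).
Proof.
move=> mB; exists i.+1; split.
  by rewrite -[X in measurable X]setTI; exact: measurable_coordinate.
by move=> w w' ww'; rewrite /preimage /mkset ww'.
Qed.

End TrajectorySpace.
Arguments trajectory {d} T.
Arguments cylinder {d} T n.
Arguments is_cylinder {d} T.

(** * Prepending one step of a kernel to a random trajectory *)

Section Prolongation.
Context {d : measure_display} {T : measurableType d} {R : realType}.
Variables (k : R.-pker T ~> T) (Q : R.-pker T ~> trajectory T).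
Local Open Scope ereal_scope.

(** One step of [k] from [x] to [y], then a continuation drawn from [Q y]; [y] is recorded, [x] is
    not. *)
Definition kcons (x : T) (U : set (trajectory T)) : \bar R :=
  \int[k x]_y Q y (tcons y @^-1` U).

Let measurable_section U : measurable U ->
  measurable_fun setT (fun y => Q y (tcons y @^-1` U)).
Proof.
move=> mU; pose V := (fun p : T * trajectory T => tcons p.1 p.2) @^-1` U.
have mV : measurable V.
  by rewrite /V -[X in measurable X]setTI; exact: measurable_tcons.
rewrite (_ : (fun y => _) = (fun y => Q y (xsection V y))); last first.
  by apply/funext => y; rewrite xsectionE.
by apply: measurable_fun_xsection_finite_kernel; rewrite inE.
Qed.

Let kcons0 x : kcons x set0 = 0.
Proof. by apply: integral0_eq => y _; rewrite preimage_set0 measure0. Qed.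

Let kcons_ge0 x U : 0 <= kcons x U.
Proof. exact: integral_ge0. Qed.

Let kcons_sigma_additive x : semi_sigma_additive (kcons x).
Proof.
move=> F mF tF mUF.
have mt y U : measurable U -> measurable (tcons y @^-1` U).
  by move=> mU; rewrite -[X in measurable X]setTI; exact: measurable_tcons1.
rewrite [X in _ --> X](_ : _ =
    \int[k x]_y (\sum_(n <oo) Q y (tcons y @^-1` F n))); last first.
  apply: eq_integral => y _; rewrite preimage_bigcup.
  apply/esym/cvg_lim => //; apply: measure_semi_sigma_additive.
  - by move=> n; exact: mt.
  - apply/trivIsetP => i j _ _ ij; rewrite -preimage_setI.
    by move/trivIsetP : tF => /(_ i j Logic.I Logic.I ij) ->; rewrite preimage_set0.
  - by rewrite -preimage_bigcup; exact: mt.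
rewrite integral_nneseries//; last by move=> n; exact: measurable_section.
by apply: is_cvg_nneseries => n _ _; exact: integral_ge0.
Qed.

HB.instance Definition _ x := isMeasure.Build _ _ R
  (kcons x) (kcons0 x) (kcons_ge0 x) (@kcons_sigma_additive x).

Definition mkcons (x : T) : {measure set (trajectory T) -> \bar R} := kcons x.

Let measurable_mkcons U : measurable U -> measurable_fun setT (mkcons ^~ U).
Proof.
move=> mU; apply: measurable_fun_integral_kernel => //.
- by move=> V mV; exact: measurable_kernel.
- exact: measurable_section.
Qed.

HB.instance Definition _ := isKernel.Build _ _ _ _ _ mkcons measurable_mkcons.

Let mkcons_prob x : mkcons x [set: trajectory T] = 1.
Proof.
rewrite /mkcons/= /kcons; under eq_integral do rewrite preimage_setT prob_kernel.
by rewrite integral_cst// mul1e prob_kernel.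
Qed.

HB.instance Definition _ :=
  Kernel_isProbability.Build _ _ _ _ _ mkcons mkcons_prob.

Lemma integral_mkcons x (f : trajectory T -> \bar R) :
  (forall w, 0 <= f w) -> measurable_fun setT f ->
  \int[mkcons x]_w f w = \int[k x]_y \int[Q y]_w f (tcons y w).
Proof.
move=> f0 mf.
rewrite (@ge0_integral_mixture _ _ _ _ _ (k x) _
  (fun y => pushforward (Q y) (tcons y)))//.
  exact: measurable_tcons1.
move=> mt; apply: eq_integral => y _; rewrite ge0_integral_pushforward//.
Qed.

End Prolongation.

(** * The finitely additive content on cylinders *)

Section CylinderContent.
Context {d : measure_display} {T : measurableType d} {R : realType}.
Variable k : R.-pker T ~> T.
Local Open Scope ereal_scope.

(* [marginal n x] is the law of the chain started at [x] (not recorded) whose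
   first n steps are recorded in the first n coordinates; the remaining
   coordinates are junk. *)
Fixpoint marginal n : R.-pker T ~> trajectory T :=
  if n is m.+1 then mkcons k (marginal m)
  else kdirac (measurable_cst (point : trajectory T)).

(** Kolmogorov consistency: peeling off first steps leads to a cylinder of order 0, which is empty
    or the whole space. *)
Lemma marginal_cylinder m n x C : (m <= n)%N -> cylinder T m C ->
  marginal n x C = marginal m x C.
Proof.
elim: m n x C => [|m IHm] [|n] x C //; rewrite ?ltnS => mn [mC Cm]; last first.
  by apply: eq_integral => y _; apply: IHm => //; exact: cylinder_tcons.
have [->|/set0P[w Cw]] := eqVneq C set0; first by rewrite !measure0.
have -> : C = setT.
  by apply/seteqP; split=> // w' _; rewrite (depends_on0 w' w Cm).
by rewrite !prob_kernel.
Qed.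

(** A copy of the type, on which the measurable sets are the cylinders, apart from the sigma-algebra
    of [trajectory]. *)
Definition cylinder_events : Type := trajectory T.
HB.instance Definition _ := Pointed.on cylinder_events.
HB.instance Definition _ := isAlgebraOfSets.Build default_measure_display
  cylinder_events (@is_cylinder0 d T) (@is_cylinderU d T) (@is_cylinderC d T).

Definition cylinder_content x (C : set cylinder_events) : \bar R :=
  limn (fun n => marginal n x C).

Lemma cylinder_contentE n x C : cylinder T n C ->
  cylinder_content x C = marginal n x C.
Proof.
move=> Cn; apply/cvg_lim => //; apply: cvg_near_cst; near=> m.
by apply: marginal_cylinder => //; near: m; exact: nbhs_infty_ge.
Unshelve. all: by end_near. Qed.

Lemma cylinder_content_ge0 x C : 0 <= cylinder_content x C.
Proof.
have [[n Cn]|nC] := pselect (is_cylinder T C).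
  by rewrite (cylinder_contentE x Cn).
rewrite /cylinder_content; case: (pselect (cvgn (fun n => marginal n x C))).
  by move=> cv; apply: lime_ge => //; apply: nearW => n.
(* Outside the cylinders the sequence may diverge; its limit is then the default point, which is
   nonnegative. *)
by move=> ncv; rewrite dvgP.
Qed.

Lemma cylinder_content_le1 x C : is_cylinder T C -> cylinder_content x C <= 1.
Proof.
move=> [n Cn]; rewrite (cylinder_contentE x Cn).
have [mC _] := Cn; rewrite -(@prob_kernel _ _ _ _ _ (marginal n) x).
by apply: le_measure; rewrite ?inE.
Qed.

Lemma cylinder_content_tcons x C : is_cylinder T C ->
  cylinder_content x C = \int[k x]_y cylinder_content y (tcons y @^-1` C).
Proof.
(* Raising the order to [n.+1] lets [marginal] unfold into a first step. *)
move=> [n /(cylinderW (leqnSn n)) Cn]; rewrite (cylinder_contentE x Cn).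
apply: eq_integral => y _.
by rewrite (cylinder_contentE y (cylinder_tcons y Cn)).
Qed.

Lemma common_cylinder (F : nat -> set (trajectory T)) n :
  (forall i, is_cylinder T (F i)) ->
  exists m, forall i, (i < n)%N -> cylinder T m (F i).
Proof.
move=> cF; elim: n => [|n [m mF]]; first by exists 0%N.
have [p Fp] := cF n; exists (maxn m p) => i; rewrite ltnS leq_eqVlt.
move=> /predU1P[->|/mF]; first exact: cylinderW (leq_maxr m p) _ Fp.
exact: cylinderW (leq_maxl m p) _.
Qed.

(** Finitely many cylinders have a common order m, at which the content is the measure
    [marginal k m x]. *)
Lemma cylinder_content_semi_additive x :
  measure_function.semi_additive (cylinder_content x).
Proof.
move=> F n cF tF _; have [m mF] := common_cylinder n cF.
have UF : cylinder T m (\big[setU/set0]_(i < n) F i).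
  rewrite -bigcup_mkord.
  pose G i : set (trajectory T) := if (i < n)%N then F i else set0.
  rewrite (_ : \bigcup_(i in _) _ = \bigcup_i G i); last first.
    rewrite bigcup_mkcond; apply: eq_bigcupr => i _; rewrite /G.
    by congr (if _ then _ else _); apply/idP/idP; rewrite inE.
  have [c0 _ cU] := cylinder_sigma_algebra (T := T) m; apply: (cU G) => i.
  by rewrite /G; case: ifPn => // /mF.
rewrite (cylinder_contentE x UF) measure_semi_additive//.
- by apply: eq_bigr => i _; rewrite (cylinder_contentE x (mF i _)).
- by move=> i; have [p [+ _]] := cF i.
- by have [] := UF.
Qed.

HB.instance Definition _ x := isContent.Build _ _ _ (cylinder_content x)
  (cylinder_content_ge0 x) (@cylinder_content_semi_additive x).

End CylinderContent.

(** * Continuity at the empty set and sigma-subadditivity *)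

Section Continuity.
Context {d : measure_display} {T : measurableType d} {R : realType}.
Variable k : R.-pker T ~> T.
Local Open Scope ereal_scope.

Lemma le_cylinder_content x C D : is_cylinder T C -> is_cylinder T D ->
  C `<=` D -> cylinder_content k x C <= cylinder_content k x D.
Proof.
by move=> cC cD CD; apply: le_measure => //; rewrite inE.
Qed.

(** The situation of a failure of continuity at the empty set, except that the intersection is not
    yet assumed empty. *)
Definition shrinking (x : T) (C : nat -> set (trajectory T)) : Prop :=
  [/\ forall n, is_cylinder T (C n),
      forall m n, (m <= n)%N -> C n `<=` C m &
      exists2 e : R, (0 < e)%R & forall n, e%:E <= cylinder_content k x (C n)].

(* If all the sections had vanishing probability, so would the cylinders, by
   dominated convergence. *)
Lemma shrinking_section x C : shrinking x C ->
  exists y, shrinking y (fun n => tcons y @^-1` C n).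
Proof.
move=> [cC niC [e e0 eC]]; apply: contrapT => noy.
pose g n y := cylinder_content k y (tcons y @^-1` C n).
have cg y n : is_cylinder T (tcons y @^-1` C n).
  by have [m /(cylinderW (leqnSn m)) Cm] := cC n; exists m; exact: cylinder_tcons.
have nig y m n : (m <= n)%N -> tcons y @^-1` C n `<=` tcons y @^-1` C m.
  by move=> mn w; exact: niC.
have g_cvg0 y : g ^~ y @ \oo --> 0.
  have := @ereal_nonincreasing_cvgn R (g ^~ y).
  set l := ereal_inf _ => /(_ _)/wrap[m n mn|gl].
    by apply: le_cylinder_content; [exact: cg|exact: cg|exact: nig].
  suff l0 : l = 0 by rewrite l0 in gl.
  have l_ge0 : 0 <= l.
    by apply: le_ereal_inf_tmp => _ [n _ <-]; exact: cylinder_content_ge0.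
  have l_le n : l <= g n y by apply: ereal_inf_lbound; exists n.
  (* A positive limit [l] would be a lower bound making the sections at [y] shrinking, against
     [noy]. *)
  apply/eqP; rewrite eq_le l_ge0 andbT leNgt; apply/negP => l_gt0.
  have lfin : l \is a fin_num.
    rewrite ge0_fin_numE// (le_lt_trans (l_le 0%N))//.
    by rewrite (le_lt_trans (cylinder_content_le1 k y (cg y _)))// ltry.
  apply: noy; exists y; split=> //; first exact: nig.
  exists (fine l); first by rewrite fine_gt0// l_gt0 -ge0_fin_numE.
  by move=> n; rewrite fineK//; exact: l_le.
have mg n : measurable_fun setT (g n).
  have [m /(cylinderW (leqnSn m)) Cm] := cC n.
  rewrite (_ : g n = fun y => marginal k m y (tcons y @^-1` C n)).
    pose V := (fun p : T * trajectory T => tcons p.1 p.2) @^-1` C n.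
    have mV : measurable V.
      rewrite /V -[X in measurable X]setTI; apply: measurable_tcons => //.
      by case: Cm.
    rewrite (_ : (fun y => _) = (fun y => marginal k m y (xsection V y))).
      by apply: measurable_fun_xsection_finite_kernel; rewrite inE.
    by apply/funext => y; rewrite xsectionE.
  apply/funext => y; apply: cylinder_contentE; exact: cylinder_tcons.
have [||||_ _ ] := @dominated_convergence _ _ _ (k x) _ measurableT g (cst 0)
   (cst 1) mg.
- exact: measurable_cst.
- by apply: aeW => y _; exact: g_cvg0.
- apply: (@bounded_integrable _ _ _ (k x) (cst 1%R) 1%R) => //.
    exact: prob_kernel.
  by move=> y /=; rewrite normr1.
- apply: aeW => y n _ /=; rewrite gee0_abs ?cylinder_content_ge0//.
  exact: cylinder_content_le1.
rewrite integral0 => lim0.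
suff : e%:E <= 0 by rewrite lee_fin leNgt e0.
rewrite -(cvg_lim _ lim0)//; apply: lime_ge; first by apply/cvg_ex; exists 0.
by apply: nearW => n /=; rewrite -cylinder_content_tcons.
Qed.

(** Sections of shrinking cylinders can be taken again and again; the points at which they are taken
    form the common trajectory. *)
Lemma shrinking_nonempty x C : shrinking x C -> exists w, forall n, C n w.
Proof.
move=> xC; pose state := {p : T * (nat -> set (trajectory T)) | shrinking p.1 p.2}.
(* Dependent choice: a state is a point with a sequence of cylinders shrinking there, so that each
   step can be followed by another. *)
have /choice[next nextE] : forall p : state, exists q : state,
    (sval q).2 = fun n => tcons (sval q).1 @^-1` (sval p).2 n.
  move=> [[y D] yD]; have [z zD] := shrinking_section yD.
  by exists (exist _ (z, fun n => tcons z @^-1` D n) zD).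
pose q n := iter n next (exist _ (x, C) xC : state).
(* The shift to [n.+1] skips the starting point [x], which is not recorded. *)
pose w : trajectory T := fun n => (sval (q n.+1)).1.
pose glue j (v : trajectory T) : trajectory T :=
  fun i => if (i < j)%N then w i else v (i - j)%N.
have qE j n v : (sval (q j)).2 n v = C n (glue j v).
  elim: j v => [|j IHj] v.
    by congr (C n _); apply/funext => i; rewrite /glue subn0.
  rewrite /q iterS nextE -/(q j) /preimage /mkset IHj; congr (C n _).
  apply/funext => i; rewrite /glue; have [ij|ji|->] := ltngtP i j.
  - by rewrite ltnS (ltnW ij).
  - by rewrite ltnS leqNgt ji/= -(subnSK ji).
  - by rewrite ltnS leqnn subnn.
exists w => n; have [cC _ _] := xC; have [m [_ Cm]] := cC n.
have [_ _ [e e0 /(_ n) eC]] := svalP (q m).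
(* After m steps the section of [C n] is not empty, as its content is at least e. A point [v] in it
   puts [glue m v] in [C n], which only sees the first m coordinates, where [glue m v] is [w]. *)
have [D0|/set0P[v Dv]] := eqVneq ((sval (q m)).2 n) set0.
  move: eC; rewrite D0 (@cylinder_contentE _ _ _ k 0%N) ?measure0.
    by rewrite lee_fin leNgt e0.
  by split.
rewrite (Cm _ (glue m v)); first by rewrite -qE.
by move=> i im; rewrite /glue im.
Qed.

(** If the inequality failed, removing finitely many [F i] from [A] would leave at least the gap
    between the two sides; a point surviving all removals lies in [A] and in no [F i]. *)
Lemma cylinder_content_sigma_subadditive x :
  measurable_subset_sigma_subadditive (cylinder_content k x).
Proof.
move=> A F cF cA AF; rewrite leNgt; apply/negP => ltA.
set S := \sum_(i <oo) cylinder_content k x (F i) in ltA.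
have S0 : 0 <= S by apply: nneseries_ge0 => i _ _; exact: cylinder_content_ge0.
have A1 := cylinder_content_le1 k x cA.
have Afin : cylinder_content k x A \is a fin_num.
  by rewrite ge0_fin_numE ?cylinder_content_ge0// (le_lt_trans A1)// ltry.
have Sfin : S \is a fin_num.
  by rewrite ge0_fin_numE// (lt_le_trans ltA)// (le_trans A1)// leey.
pose B n := A `\` \big[setU/set0]_(i < n) F i.
have cU n : @measurable _ (cylinder_events (T := T)) (\big[setU/set0]_(i < n) F i).
  exact: bigsetU_measurable.
have cB n : is_cylinder T (B n) by exact: (@measurableD _ (cylinder_events (T := T))).
have [|w Bw] := @shrinking_nonempty x B.
- split=> //.
    move=> m n mn w [Aw nFw]; split=> //; apply: contra_not nFw.
    by apply: subset_bigsetU.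
  exists (fine (cylinder_content k x A) - fine S)%R.
    by rewrite subr_gt0 fine_lt.
  move=> n; rewrite EFinB !fineK// leeBlDr//.
  (* [A] is covered by [B n] and the first n sets [F i], listed by [G] with [B n] in front. *)
  pose G i := if i is j.+1 then F j else B n.
  have AG : cylinder_content k x A <= \sum_(i < n.+1) cylinder_content k x (G i).
    apply: content_subadditive => //; first by case=> [|i] _; [exact: cB|exact: cF].
    move=> w Aw; rewrite big_ord_recl /=.
    by have [Uw|nUw] := pselect ((\big[setU/set0]_(i < n) F i) w); [right|left].
  apply: le_trans AG _; rewrite big_ord_recl /= leeD2l//.
  rewrite -(big_mkord xpredT (fun i => cylinder_content k x (F i))).
  by apply: nneseries_lim_ge => i _ _; exact: cylinder_content_ge0.
have [Aw _] := Bw 0%N; have [i _ Fiw] := AF _ Aw.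
by have [_] := Bw i.+1; apply; rewrite big_ord_recr; right.
Qed.

HB.instance Definition _ x := Content_SigmaSubAdditive_isMeasure.Build _ _ _
  (cylinder_content k x) (@cylinder_content_sigma_subadditive x).

End Continuity.

(** * Extension to a probability measure and its Markov property *)

Section IonescuTulcea.
Context {d : measure_display} {T : measurableType d} {R : realType}.
Variable k : R.-pker T ~> T.
Local Open Scope ereal_scope.

(** The Caratheodory extension lives on the sigma-algebra generated by the cylinders; the identity
    carries it over to [trajectory]. *)
Lemma measurable_generated_by_cylinders :
  measurable_fun [set: g_sigma_algebraType (@measurable _ (@cylinder_events d T))]
    (id : _ -> trajectory T).
Proof.
apply: measurable_fun_trajectory => i _ B mB; rewrite setTI.
by apply: sub_sigma_algebra; exact: is_cylinder_coordinate.
Qed.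

Definition trajectory_law (x : T) : set (trajectory T) -> \bar R :=
  pushforward (measure_extension (cylinder_content k x))
    (id : _ -> trajectory T).

Let trajectory_law0 x : trajectory_law x set0 = 0.
Proof. exact: mu_ext0. Qed.

Let trajectory_law_ge0 x U : 0 <= trajectory_law x U.
Proof. exact: mu_ext_ge0. Qed.

Let trajectory_law_sigma_additive x : semi_sigma_additive (trajectory_law x).
Proof.
move=> F mF tF mUF.
have mI (U : set (trajectory T)) : measurable U ->
    @measurable _ (g_sigma_algebraType (@measurable _ (@cylinder_events d T))) U.
  by move=> mU; have := measurable_generated_by_cylinders measurableT mU; rewrite setTI.
apply: (@measure_semi_sigma_additive _ _ _
  (measure_extension (cylinder_content k x)) F) => //.
- by move=> i; exact: mI.
- exact: mI.
Qed.

HB.instance Definition _ x := isMeasure.Build _ _ _ (trajectory_law x)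
  (trajectory_law0 x) (trajectory_law_ge0 x) (@trajectory_law_sigma_additive x).

Lemma trajectory_law_cylinder n x C : cylinder T n C ->
  trajectory_law x C = marginal k n x C.
Proof.
move=> Cn; rewrite -(cylinder_contentE k x Cn).
by apply: (@measurable_mu_extE _ _ (@cylinder_events d T)); exists n.
Qed.

Let trajectory_law_setT x : trajectory_law x setT = 1.
Proof. by rewrite (@trajectory_law_cylinder 0%N)// prob_kernel. Qed.

HB.instance Definition _ x := Measure_isProbability.Build _ _ _
  (trajectory_law x) (trajectory_law_setT x).

Definition truncate n (w : trajectory T) : trajectory T :=
  fun i => if (i < n)%N then w i else point.

Lemma measurable_truncate n : measurable_fun setT (truncate n).
Proof.
apply: measurable_fun_trajectory => i; rewrite /truncate.
case: (i < n)%N; first exact: measurable_coordinate.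
exact: measurable_cst.
Qed.

(** [g] factors through [truncate n]. Preimages under [truncate n] are cylinders of order n, on
    which the two laws agree, so they have the same image under it. *)
Lemma integral_trajectory_law n x (g : trajectory T -> \bar R) :
  (forall w, 0 <= g w) -> measurable_fun setT g -> depends_on n g ->
  \int[trajectory_law x]_w g w = \int[marginal k n x]_w g w.
Proof.
move=> g0 mg gn.
have gE w : g w = g (truncate n w).
  by apply: gn => i ni; rewrite /truncate ni.
have mt := measurable_truncate n.
transitivity (\int[trajectory_law x]_w (g \o truncate n) w).
  by apply: eq_integral => w _; exact: gE.
transitivity (\int[marginal k n x]_w (g \o truncate n) w); last first.
  by apply: eq_integral => w _; exact/esym/gE.
have pushE (mu : {measure set (trajectory T) -> \bar R}) :
    \int[mu]_w (g \o truncate n) w = \int[pushforward mu (truncate n)]_w g w.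
  by rewrite [RHS](ge0_integral_pushforward mt).
rewrite !pushE.
apply: eq_measure_integral => A mA _; apply: trajectory_law_cylinder.
split; first by rewrite -[X in measurable X]setTI; exact: mt.
move=> w w' ww'; rewrite /preimage /mkset (_ : truncate n w = truncate n w')//.
by apply/funext => i; rewrite /truncate; case: ifP => // /ww'.
Qed.

Definition update (w : trajectory T) n (y : T) : trajectory T :=
  fun i => if i == n then y else w i.

Lemma measurable_update n :
  measurable_fun setT (fun p : trajectory T * T => update p.1 n p.2).
Proof.
apply: measurable_fun_trajectory => i; rewrite /update.
case: (i == n); first exact: measurable_snd.
exact: (measurableT_comp (measurable_coordinate i) measurable_fst).
Qed.

(** [tcons x w n] is the position before step n: [x] for n = 0, and coordinate n - 1 otherwise. *)
Definition next_step x n (w : trajectory T) : {measure set T -> \bar R} :=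
  k (tcons x w n).

Let measurable_next_step x n U :
  measurable U -> measurable_fun setT (next_step x n ^~ U).
Proof.
move=> mU; apply: (measurableT_comp (measurable_kernel k U mU)).
by case: n => [|n]; [exact: measurable_cst|exact: measurable_coordinate].
Qed.

HB.instance Definition _ x n :=
  isKernel.Build _ _ _ _ _ (next_step x n) (@measurable_next_step x n).

Let next_step_prob x n w : next_step x n w [set: T] = 1.
Proof. exact: prob_kernel. Qed.

HB.instance Definition _ x n :=
  Kernel_isProbability.Build _ _ _ _ _ (next_step x n) (@next_step_prob x n).

Lemma measurable_integral_update x n (g : trajectory T -> \bar R) :
  (forall w, 0 <= g w) -> measurable_fun setT g ->
  measurable_fun setT (fun w => \int[k (tcons x w n)]_y g (update w n y)).
Proof.
move=> g0 mg.
apply: (@measurable_fun_integral_finite_kernel _ _ _ _ _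
  (fun p : trajectory T * T => g (update p.1 n p.2)) (next_step x n)) => //.
exact: (measurableT_comp mg (measurable_update n)).
Qed.

(** [marginal] grows by a step at the front, whereas the Markov property concerns the last step; the
    induction, with [x] varying, carries the last step past the first. *)
Lemma marginal_markov n x (g : trajectory T -> \bar R) :
  (forall w, 0 <= g w) -> measurable_fun setT g -> depends_on n.+1 g ->
  \int[marginal k n.+1 x]_w g w =
  \int[marginal k n x]_w \int[k (tcons x w n)]_y g (update w n y).
Proof.
elim: n x g => [|n IHn] x g g0 mg gn.
  have dep w w' y : g (tcons y w) = g (update w' 0%N y) by apply: gn; case.
  rewrite integral_mkcons// [RHS](_ : _ = \int[marginal k 0%N x]_w
      (\int[k x]_y g (update point 0%N y))); last first.
    apply: eq_integral => w _; apply: eq_integral => y _.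
    by rewrite -(dep point w) (dep point point).
  rewrite integral_cst// prob_kernel mule1; apply: eq_integral => y _.
  rewrite (_ : (fun w => _) = cst (g (update point 0%N y))).
    by rewrite integral_cst// prob_kernel mule1.
  by apply/funext => w; exact: dep.
rewrite integral_mkcons// [RHS]integral_mkcons//; last 2 first.
- by move=> w; exact: integral_ge0.
- exact: measurable_integral_update.
apply: eq_integral => y _.
rewrite (IHn y (g \o tcons y)); last 3 first.
- by move=> w; exact: g0.
- exact: (measurableT_comp mg (measurable_tcons1 y)).
- exact: depends_on_tcons.
apply: eq_integral => w _; apply: eq_integral => z _ /=; congr g.
by apply/funext => -[|i].
Qed.

(** Coordinate n may be resampled from its predecessor. Both integrands depend on finitely many
    coordinates, so the identity transfers from the marginals. *)
Theorem ionescu_tulcea_markov n x (g : trajectory T -> \bar R) :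
  (forall w, 0 <= g w) -> measurable_fun setT g -> depends_on n.+1 g ->
  \int[trajectory_law x]_w g w =
  \int[trajectory_law x]_w \int[k (tcons x w n)]_y g (update w n y).
Proof.
move=> g0 mg gn; rewrite (integral_trajectory_law x g0 mg gn) marginal_markov//.
rewrite [RHS](@integral_trajectory_law n)//.
- by move=> w; exact: integral_ge0.
- exact: measurable_integral_update.
- move=> w w' ww'; have -> : tcons x w n = tcons x w' n.
    by case: n {gn} ww' => [//|n] ww'; exact: ww'.
  apply: eq_integral => y _; apply: gn => i; rewrite ltnS leq_eqVlt /update.
  by case: eqP => //= _ /ww'.
Qed.

End IonescuTulcea.

(** * Bounded measurable functions under a probability measure *)

Section BoundedMeasurable.
Context {d : measure_display} {T : measurableType d} {R : realType}.
Implicit Types f g : T -> R.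

(** On this class the real-valued integral under a probability measure is finite, linear and
    monotone, with no integrability left to check. *)
Definition bounded_measurable f : Prop :=
  measurable_fun setT f /\ exists C, forall x, `|f x| <= C.

Lemma bounded_measurable_cst c : bounded_measurable (fun=> c).
Proof. by split; [exact: measurable_cst|exists `|c|]. Qed.

Lemma bounded_measurableD f g : bounded_measurable f -> bounded_measurable g ->
  bounded_measurable (fun x => f x + g x).
Proof.
move=> [mf [C fC]] [mg [D gD]]; split; first exact: measurable_funD.
by exists (C + D) => x; rewrite (le_trans (ler_normD _ _))// lerD.
Qed.

Lemma bounded_measurableM f g : bounded_measurable f -> bounded_measurable g ->
  bounded_measurable (fun x => f x * g x).
Proof.
move=> [mf [C fC]] [mg [D gD]]; split; first exact: measurable_funM.
by exists (C * D) => x; rewrite normrM ler_pM.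
Qed.

Lemma bounded_measurableZ c f : bounded_measurable f ->
  bounded_measurable (fun x => c * f x).
Proof. exact/bounded_measurableM/bounded_measurable_cst. Qed.

Lemma bounded_measurableB f g : bounded_measurable f -> bounded_measurable g ->
  bounded_measurable (fun x => f x - g x).
Proof.
move=> bf bg; apply: bounded_measurableD => //.
have := bounded_measurableZ (-1) bg.
by under eq_fun do rewrite mulN1r.
Qed.

Lemma bounded_measurable_sum (I : finType) (F : I -> T -> R) :
  (forall i, bounded_measurable (F i)) ->
  bounded_measurable (fun x => \sum_(i in I) F i x).
Proof.
move=> bF; split; first by apply: measurable_sum => i; case: (bF i).
have /choice[C FC] i : exists C, forall x, `|F i x| <= C by case: (bF i).
exists (\sum_i C i) => x; rewrite (le_trans (ler_norm_sum _ _ _))//.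
exact: ler_sum.
Qed.

Lemma bounded_measurable_integrable (mu : {measure set T -> \bar R}) f :
  mu setT = 1%E -> bounded_measurable f -> mu.-integrable setT (EFin \o f).
Proof. by move=> mu1 [mf [C fC]]; exact: bounded_integrable fC. Qed.

Lemma Rintegral_prob_cst (mu : {measure set T -> \bar R}) c :
  mu setT = 1%E -> \int[mu]_x c = c.
Proof. by move=> mu1; rewrite Rintegral_cst// mu1 mulr1. Qed.

Lemma le_Rintegral_prob (mu : {measure set T -> \bar R}) f g :
  mu setT = 1%E -> bounded_measurable f -> bounded_measurable g ->
  (forall x, f x <= g x) -> \int[mu]_x f x <= \int[mu]_x g x.
Proof.
by move=> mu1 bf bg fg; apply: le_Rintegral => //;
  exact: bounded_measurable_integrable.
Qed.

Lemma norm_Rintegral_prob (mu : {measure set T -> \bar R}) f C :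
  mu setT = 1%E -> measurable_fun setT f -> (forall x, `|f x| <= C) ->
  `|\int[mu]_x f x| <= C.
Proof.
move=> mu1 mf fC; have bf : bounded_measurable f by split=> //; exists C.
rewrite -[C](Rintegral_prob_cst C mu1) ler_norml; apply/andP; split.
  rewrite Rintegral_prob_cst// -(Rintegral_prob_cst (- C) mu1).
  apply: le_Rintegral_prob => //; first exact: bounded_measurable_cst.
  by move=> x; have := fC x; rewrite ler_norml => /andP[].
apply: le_Rintegral_prob => //; first exact: bounded_measurable_cst.
by move=> x; have := fC x; rewrite ler_norml => /andP[].
Qed.

Lemma RintegralD_prob (mu : {measure set T -> \bar R}) f g :
  mu setT = 1%E -> bounded_measurable f -> bounded_measurable g ->
  \int[mu]_x (f x + g x) = \int[mu]_x f x + \int[mu]_x g x.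
Proof.
by move=> mu1 bf bg; rewrite RintegralD//; exact: bounded_measurable_integrable.
Qed.

Lemma RintegralZ_prob (mu : {measure set T -> \bar R}) c f :
  mu setT = 1%E -> bounded_measurable f ->
  \int[mu]_x (c * f x) = c * \int[mu]_x f x.
Proof.
by move=> mu1 bf; rewrite RintegralZl//; exact: bounded_measurable_integrable.
Qed.

Lemma Rintegral_prob_sum (mu : {measure set T -> \bar R}) (I : finType)
    (F : I -> T -> R) :
  mu setT = 1%E -> (forall i, bounded_measurable (F i)) ->
  \int[mu]_x (\sum_(i in I) F i x) = \sum_(i in I) \int[mu]_x F i x.
Proof.
move=> mu1 bF; under eq_Rintegral do rewrite -big_enum/=.
rewrite -big_enum/=; elim: (enum I) => [|i s IHs].
  by under eq_Rintegral do rewrite big_nil; rewrite big_nil Rintegral_prob_cst.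
under eq_Rintegral do rewrite big_cons.
rewrite big_cons RintegralD_prob//; first by rewrite -IHs.
split; first by apply: measurable_sum => j; case: (bF j).
have /choice[C FC] j : exists C, forall x, `|F j x| <= C by case: (bF j).
exists (\sum_(j <- s) C j) => x; rewrite (le_trans (ler_norm_sum _ _ _))//.
exact: ler_sum.
Qed.

Lemma EFin_Rintegral_prob (mu : {measure set T -> \bar R}) f :
  mu setT = 1%E -> bounded_measurable f ->
  (\int[mu]_x f x)%:E = (\int[mu]_x (f x)%:E)%E.
Proof.
move=> mu1 bf; rewrite fineK//; apply: integrable_fin_num => //.
exact: bounded_measurable_integrable.
Qed.

End BoundedMeasurable.

Section RealMixture.
Context {d d' : measure_display} {Y : measurableType d} {Z : measurableType d'}
  {R : realType}.
Implicit Types f : Z -> R.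

Lemma bounded_measurable_kernel (k : Y -> {measure set Z -> \bar R}) f :
  (forall U, measurable U -> measurable_fun [set: Y] (k ^~ U)) ->
  (forall y, k y setT = 1%E) -> bounded_measurable f ->
  bounded_measurable (fun y => \int[k y]_z f z).
Proof.
move=> mk k1 bf; have [mf [C fC]] := bf; split; last first.
  by exists C => y; exact: norm_Rintegral_prob.
(* Measurability of the integral in the parameter is available for nonnegative integrands, whence
   the shift by [C]. *)
rewrite (_ : (fun y => _) = (fun y => \int[k y]_z (f z + C) - C)); last first.
  apply/funext => y; rewrite RintegralD_prob ?Rintegral_prob_cst ?addrK//.
  exact: bounded_measurable_cst.
apply: measurable_funB; last exact: measurable_cst.
apply: measurableT_comp; first exact: fine_measurable.
apply: measurable_fun_integral_kernel => //.
  by move=> z; rewrite lee_fin -lerBlDr sub0r; have /ler_normlP[] := fC z; lra.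
by apply/measurable_EFinP/measurable_funD => //; exact: measurable_cst.
Qed.

(** The law of [X] is a mixture of the [k y]. Adding [C] makes the function nonnegative, and the
    constants cancel since all masses are 1. *)
Lemma Rintegral_mixture (mu : {measure set Y -> \bar R}) (X : Y -> Z)
    (k : Y -> {measure set Z -> \bar R}) f :
  measurable_fun setT X ->
  (forall U, measurable U -> measurable_fun [set: Y] (k ^~ U)) ->
  (forall y, k y setT = 1%E) -> mu setT = 1%E ->
  (forall U, measurable U -> mu (X @^-1` U) = \int[mu]_y k y U)%E ->
  bounded_measurable f ->
  \int[mu]_y f (X y) = \int[mu]_y \int[k y]_z f z.
Proof.
move=> mX mk k1 mu1 muE bf; have [mf [C fC]] := bf.
have bC := @bounded_measurable_cst _ Z R C.
have bfC : bounded_measurable (fun z => f z + C) by exact: bounded_measurableD.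
have bX (g : Z -> R) : bounded_measurable g -> bounded_measurable (g \o X).
  move=> [mg [D gD]]; split; first exact: measurableT_comp.
  by exists D => y; exact: gD.
have bk g : bounded_measurable g -> bounded_measurable (fun y => \int[k y]_z g z).
  exact: bounded_measurable_kernel.
suff : \int[mu]_y (f (X y) + C) = \int[mu]_y \int[k y]_z (f z + C).
  under [RHS]eq_Rintegral do rewrite RintegralD_prob// Rintegral_prob_cst//.
  rewrite !RintegralD_prob//; [exact: addIr|exact: bk| |exact: bX|];
    exact: bounded_measurable_cst.
apply: EFin_inj; rewrite !EFin_Rintegral_prob//; [|exact: bk|exact: (bX _ bfC)].
have fC0 z : (0 <= (f z + C)%:E)%E.
  by rewrite lee_fin; have /ler_normlP[] := fC z; lra.
have mfC : measurable_fun setT (fun z => (f z + C)%:E).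
  by apply/measurable_EFinP; case: bfC.
transitivity (\int[pushforward mu X]_z (f z + C)%:E)%E.
  by rewrite ge0_integral_pushforward.
rewrite (@ge0_integral_mixture _ _ _ _ _ mu _ k)//.
by apply: eq_integral => y _; rewrite EFin_Rintegral_prob.
Qed.

End RealMixture.

(** * Geometric convergence *)

Lemma geometric_uniform_limit {X : Type} {R : realType} (u : nat -> X -> R)
    (c C : R) : 0 <= c -> c < 1 ->
  (forall n x, `|u n.+1 x - u n x| <= c ^+ n * C) ->
  exists U : X -> R, (forall x, u n x @[n --> \oo] --> U x) /\
    forall n x, `|U x - u n x| <= c ^+ n * (C / (1 - c)).
Proof.
move=> c0 c1 uC; have c1' : 0 < 1 - c by rewrite subr_gt0.
(* The bound is the exact sum of the j geometric increments after rank n, so that the induction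
   closes with an equality. *)
have tail n j x : `|u (n + j)%N x - u n x| <= c ^+ n * (C / (1 - c)) * (1 - c ^+ j).
  elim: j => [|j IHj]; first by rewrite addn0 subrr normr0 expr0 subrr mulr0.
  rewrite addnS -(subrKA (u (n + j)%N x)) addrC (le_trans (ler_normD _ _))//.
  apply: (le_trans (lerD IHj (uC _ _))).
  rewrite exprS exprD le_eqVlt; apply/orP; left; apply/eqP.
  by field; rewrite gt_eqF.
(* Over an empty [X] the bound says nothing on the sign of [C], hence the argument [x]. *)
have C0 (x : X) : 0 <= C.
  by have := le_trans (normr_ge0 _) (uC 0%N x); rewrite mul1r.
have tail' n j x : `|u (n + j)%N x - u n x| <= c ^+ n * (C / (1 - c)).
  apply: (le_trans (tail _ _ _)); rewrite ler_piMr//.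
    by rewrite mulr_ge0 ?exprn_ge0// divr_ge0// ?(C0 x)// ltW.
  by rewrite lerBlDr lerDl exprn_ge0.
have cvu x : cvgn (u ^~ x).
  have -> : u ^~ x = (fun n => u 0%N x + series (fun j => u j.+1 x - u j x) n).
    apply/funext => n; rewrite /series/= telescope_sumr// addrC subrK//.
  apply: is_cvgD; first exact: is_cvg_cst.
  apply: normed_cvg; apply: (@series_le_cvg _ _ (geometric C c)).
  - by move=> n; exact: normr_ge0.
  - by move=> n; rewrite /geometric/= mulr_ge0 ?exprn_ge0// (C0 x).
  - by move=> n; rewrite /geometric/= mulrC.
  - by apply: is_cvg_geometric_series; rewrite ger0_norm.
exists (fun x => limn (u ^~ x)); split=> [x|n x]; first exact: cvu.
have cvn : `|u m x - u n x| @[m --> \oo] --> `|limn (u ^~ x) - u n x|.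
  by apply: cvg_norm; apply: cvgB; [exact: cvu|exact: cvg_cst].
rewrite -(cvg_lim _ cvn)//; apply: limr_le; first by apply/cvg_ex; eexists; exact: cvn.
near=> m; have nm : (n <= m)%N by near: m; exact: nbhs_infty_ge.
by rewrite -(subnKC nm).
Unshelve. all: by end_near. Qed.

Lemma le_geometric_vanishing {R : realType} (x y c C : R) : 0 <= c -> c < 1 ->
  (forall n, x <= y + c ^+ n * C) -> x <= y.
Proof.
move=> c0 c1 xyC.
have cv : y + c ^+ n * C @[n --> \oo] --> y.
  rewrite -[X in _ --> X]addr0 -(mul0r C); apply: cvgD; first exact: cvg_cst.
  by apply: cvgMl; apply: cvg_expr; rewrite ger0_norm.
rewrite -(cvg_lim _ cv)//; apply: limr_ge; first by apply/cvg_ex; exists y.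
exact: nearW.
Qed.

(** * Entropy and Bellman operators *)

Section Gibbs.
Context {A : finType} {R : realType}.
Implicit Types (q rho f : A -> R) (eta : R).

Lemma ln_le_subr1 (x : R) : 0 < x -> ln x <= x - 1.
Proof.
by move=> x0; rewrite lerBrDl -{2}(lnK x0) ?posrE// expR_ge1Dx.
Qed.

(** Equality case of ln x <= x - 1, without derivatives: with x = y^2, the assumption and ln y <= y
    - 1 give y^2 - 1 <= 2 (y - 1), that is (y - 1)^2 <= 0. *)
Lemma ln_eq_subr1 (x : R) : 0 < x -> x - 1 <= ln x -> x = 1.
Proof.
move=> x0; have [y y0 ->] : exists2 y, 0 < y & x = y ^+ 2.
  by exists (Num.sqrt x); rewrite ?sqrtr_gt0// sqr_sqrtr// ltW.
rewrite lnXn// -mulr_natl => yln.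
have : (y - 1) ^+ 2 == 0.
  by rewrite eq_le sqr_ge0 andbT; have := ln_le_subr1 y0; nra.
by rewrite expf_eq0/= subr_eq0 => /eqP ->; rewrite expr1n.
Qed.

Lemma sum_expR_gt0 f : (0 < #|A|)%N -> 0 < \sum_(b in A) expR (f b).
Proof.
move=> /card_gt0P[a _]; rewrite (bigD1 a)//= ltr_wpDr ?expR_gt0//.
by apply: sumr_ge0 => b _; exact: expR_ge0.
Qed.

(** Subtracting [rho c - q c], which sums to 0, makes every term of the divergence nonnegative. All
    terms then vanish, and the equality case of ln x <= x - 1 applies at x = q / rho. *)
Lemma KL_le0 rho q : (forall b, 0 < rho b) -> (forall b, 0 < q b) ->
  \sum_(b in A) rho b = 1 -> \sum_(b in A) q b = 1 ->
  KL rho q <= 0 -> forall b, rho b = q b.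
Proof.
move=> rho0 q0 rho1 q1 KLle b.
pose t c := rho c * ln (rho c / q c) - (rho c - q c).
have tE c : t c = rho c * ((q c / rho c - 1) - ln (q c / rho c)).
  rewrite /t !ln_div ?posrE//; field; exact: lt0r_neq0.
have t0 c : 0 <= t c.
  rewrite tE mulr_ge0 ?(ltW (rho0 c))// subr_ge0 ln_le_subr1//.
  by rewrite divr_gt0.
have sumt : \sum_(c in A) t c = KL rho q.
  by rewrite big_split/= sumrN big_split/= sumrN rho1 q1 subrr subr0.
have tb : t b = 0.
  apply/eqP; rewrite eq_le t0 andbT (le_trans _ KLle)// -sumt (bigD1 b)//=.
  by rewrite lerDl sumr_ge0.
have qr0 : 0 < q b / rho b by rewrite divr_gt0.
have qr1 : q b / rho b = 1.
  apply: ln_eq_subr1 => //; rewrite -subr_le0.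
  move: tb; rewrite tE => /eqP; rewrite mulf_eq0 gt_eqF//= => /eqP ->//.
by rewrite -[LHS]mul1r -qr1 divfK// gt_eqF.
Qed.

Lemma KL_id q : (forall b, 0 < q b) -> KL q q = 0.
Proof.
by move=> q0; rewrite /KL big1// => b _; rewrite divff ?gt_eqF// ln1 mulr0.
Qed.

(** Termwise, this is ln x <= x - 1 at x = (exp(f b / eta) / Z) / rho b, multiplied by eta * rho b;
    the upper bounds sum to 0. Actions with [rho b = 0] are treated apart. *)
Lemma entropy_variational eta rho f : 0 < eta -> (0 < #|A|)%N ->
  (forall b, 0 <= rho b) -> \sum_(b in A) rho b = 1 ->
  \sum_(b in A) rho b * (f b - eta * ln (rho b)) <=
  eta * ln (\sum_(b in A) expR (f b / eta)).
Proof.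
move=> eta0 A0 rho0 rho1; set Z := \sum_(b in A) expR _.
have Z0 : 0 < Z by exact: (sum_expR_gt0 (fun b => f b / eta)).
have le_term b : rho b * (f b - eta * ln (rho b)) - eta * ln Z * rho b <=
    eta * (expR (f b / eta) / Z - rho b).
  have [rb0|] := ltP 0 (rho b); last first.
    move=> rb; have -> : rho b = 0 by apply/eqP; rewrite eq_le rb rho0.
    by rewrite mul0r mulr0 !subr0 mulr_ge0 ?(ltW eta0)// divr_ge0 ?expR_ge0 ?ltW.
  have x0 : 0 < expR (f b / eta) / Z / rho b by rewrite !divr_gt0 ?expR_gt0.
  have := ln_le_subr1 x0.
  rewrite !ln_div ?posrE ?divr_gt0 ?expR_gt0// expRK.
  rewrite -(ler_pM2l (mulr_gt0 eta0 rb0)); congr (_ <= _).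
    by field; exact: lt0r_neq0.
  by field; rewrite !gt_eqF.
have : \sum_(b in A) (rho b * (f b - eta * ln (rho b)) - eta * ln Z * rho b) <=
    \sum_(b in A) eta * (expR (f b / eta) / Z - rho b).
  by apply: ler_sum => b _; exact: le_term.
rewrite big_split/= sumrN -mulr_sumr rho1 mulr1 -mulr_sumr big_split/= sumrN.
by rewrite rho1 -mulr_suml divff ?gt_eqF// subrr mulr0 subr_le0.
Qed.

End Gibbs.

(** * Softmax policies and the improvement step *)

Section Softmax.
Context {d : measure_display} {S : measurableType d} {A : finType}
  {R : realType}.
Hypothesis A0 : (0 < #|A|)%N.
Implicit Types (pi f Q : S -> A -> R) (eta : R).

Lemma softmax_gt0 f s a : 0 < softmax f s a.
Proof. by rewrite divr_gt0 ?expR_gt0 ?sum_expR_gt0. Qed.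

Lemma softmax_sum1 f s : \sum_(a in A) softmax f s a = 1.
Proof. by rewrite -mulr_suml divff// gt_eqF ?sum_expR_gt0. Qed.

Lemma measurable_sum_expR f : (forall a, measurable_fun setT (f ^~ a)) ->
  measurable_fun setT (fun s => \sum_(b in A) expR (f s b)).
Proof.
move=> mf; apply: measurable_sum => b.
exact: (measurableT_comp (@measurable_expR R) (mf b)).
Qed.

Lemma softmax_policy f : (forall a, measurable_fun setT (f ^~ a)) ->
  policy (softmax f).
Proof.
move=> mf; split=> [a|s a|s]; [|exact/ltW/softmax_gt0|exact: softmax_sum1].
(* As an exponential of a difference, the quotient is measurable by composition. *)
rewrite (_ : (fun s => _) =
    fun s => expR (f s a - ln (\sum_(b in A) expR (f s b)))).
  apply: (measurableT_comp (@measurable_expR R)); apply: measurable_funB => //.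
  exact: (measurableT_comp (@measurable_ln R) (measurable_sum_expR mf)).
by apply/funext => s; rewrite expRB lnK// posrE sum_expR_gt0.
Qed.

(** The target is itself in the softmax class because [Q] is measurable, so the minimal divergence
    is 0 at every state, and divergence 0 forces equality. *)
Lemma soft_improvementE eta Q pi :
  (forall a, measurable_fun setT (fun s => Q s a)) ->
  soft_improvement eta Q pi -> pi = softmax (fun s a => Q s a / eta).
Proof.
move=> mQ [[f [mf piE]] pi_min]; apply/funext => s; apply/funext => a.
have mQeta b : measurable_fun setT (fun s => Q s b / eta).
  by apply: measurable_funM => //; exact: measurable_cst.
apply: KL_le0 => [b|b|||].
- by rewrite piE softmax_gt0.
- exact: softmax_gt0.
- by under eq_bigr do rewrite piE; exact: softmax_sum1.
- exact: softmax_sum1.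
- apply: (le_trans (pi_min s (softmax (fun s a => Q s a / eta)) _)).
    by exists (fun s a => Q s a / eta).
  by rewrite KL_id// => b; exact: softmax_gt0.
Qed.

End Softmax.

(** * Bellman operators: comparison and fixed points *)

Section Bellman.
Context {d : measure_display} {S : measurableType d} {A : finType}
  {R : realType}.
Variable M : mdp S A R.
Implicit Types (pi Q : S -> A -> R) (eta : R) (V : (S -> A -> R) -> S -> R).

Lemma bounded_qfunP Q :
  bounded_qfun Q <-> forall a, bounded_measurable (fun s => Q s a).
Proof.
split=> [[mQ [C QC]] a|bQ]; first by split=> //; exists C.
split=> [a|]; first by case: (bQ a).
have /choice[C QC] a : exists C, forall s, `|Q s a| <= C by case: (bQ a).
exists (\sum_a C a) => s a; rewrite (le_trans (QC a s))// (bigD1 a)//= lerDl.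
by apply: sumr_ge0 => b _; exact: le_trans (normr_ge0 _) (QC b s).
Qed.

(* Common properties of [Q |-> \sum_b pi b * (Q b - eta * ln (pi b))] and of its
   supremum over the policies [pi]. *)
Definition value_operator V : Prop :=
  (forall Q, bounded_qfun Q -> bounded_measurable (V Q)) /\
  (forall Q Q' c, (forall s a, Q s a <= Q' s a + c) ->
     forall s, V Q s <= V Q' s + c).

(** For [V := soft_value eta pi] this is convertible to [soft_bellman M eta pi]; for [V := lse eta]
    it is the optimality operator. *)
Definition bellman V Q : S -> A -> R :=
  fun s a => reward M s a + discount M * \int[trans M a s]_s' V Q s'.

Let discount_ge0M : 0 <= discount M. Proof. exact: discount_ge0. Qed.
Let discount_lt1M : discount M < 1. Proof. exact: discount_lt1. Qed.

Lemma bounded_measurable_trans a (f : S -> R) : bounded_measurable f ->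
  bounded_measurable (fun s => \int[trans M a s]_s' f s').
Proof.
move=> bf; apply: bounded_measurable_kernel => //.
- by move=> U mU; exact: measurable_kernel.
- by move=> s; exact: prob_kernel.
Qed.

Lemma bellman_bounded V Q : value_operator V -> bounded_qfun Q ->
  bounded_qfun (bellman V Q).
Proof.
move=> [bV _] bQ; apply/bounded_qfunP => a; apply: bounded_measurableD.
  split; first exact: reward_measurable.
  by have [C rC] := reward_bounded M; exists C.
apply: bounded_measurableZ; apply: bounded_measurable_trans; exact: bV.
Qed.

(** The one-sided form contains monotonicity, at [c := 0], as well as contraction. *)
Lemma bellman_le V Q Q' c : value_operator V -> bounded_qfun Q ->
  bounded_qfun Q' -> (forall s a, Q s a <= Q' s a + c) ->
  forall s a, bellman V Q s a <= bellman V Q' s a + discount M * c.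
Proof.
move=> [bV leV] bQ bQ' QQ' s a; rewrite -addrA -mulrDr lerD2l ler_wpM2l//.
have k1 : trans M a s setT = 1%E by exact: prob_kernel.
rewrite -[c in leRHS](Rintegral_prob_cst c k1) -RintegralD_prob//.
- apply: le_Rintegral_prob => //; first exact: bV.
    apply: bounded_measurableD; first exact: bV.
    exact: bounded_measurable_cst.
  exact: leV.
- exact: bV.
- exact: bounded_measurable_cst.
Qed.

Lemma bellman_dist V Q Q' c : value_operator V -> bounded_qfun Q ->
  bounded_qfun Q' -> (forall s a, `|Q s a - Q' s a| <= c) ->
  forall s a, `|bellman V Q s a - bellman V Q' s a| <= discount M * c.
Proof.
move=> vV bQ bQ' QQ' s a; rewrite ler_distlC; apply/andP; split.
  rewrite lerBlDr; apply: bellman_le => // {}s {}a.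
  by have := QQ' s a; rewrite ler_distl => /andP[_]; rewrite addrC.
apply: bellman_le => // {}s {}a.
by have := QQ' s a; rewrite ler_distlC => /andP[_].
Qed.

Lemma bellman_mono V V' Q : value_operator V -> value_operator V' ->
  bounded_qfun Q -> (forall s, V Q s <= V' Q s) ->
  forall s a, bellman V Q s a <= bellman V' Q s a.
Proof.
move=> [bV _] [bV' _] bQ VV' s a; rewrite lerD2l ler_wpM2l//.
by apply: le_Rintegral_prob; [exact: prob_kernel|exact: bV|exact: bV'|].
Qed.

(** Bounds on [Q] and [Q'] give [Q <= Q' + (C + D)], and each application of the operator multiplies
    the excess by the discount. *)
Lemma bellman_comparison V Q Q' : value_operator V -> bounded_qfun Q ->
  bounded_qfun Q' -> (forall s a, Q s a <= bellman V Q s a) ->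
  (forall s a, bellman V Q' s a <= Q' s a) -> forall s a, Q s a <= Q' s a.
Proof.
move=> vV bQ bQ' sub sup s a.
have [[_ [C QC]] [_ [D QD]]] := (bQ, bQ').
suff le_n n : forall s a, Q s a <= Q' s a + discount M ^+ n * (C + D).
  by apply: (le_geometric_vanishing discount_ge0M discount_lt1M) => n.
elim: n => [|n IHn] {}s {}a.
  have /ler_normlP[_ QCs] := QC s a; have /ler_normlP[QDs _] := QD s a.
  by rewrite expr0 mul1r; lra.
rewrite (le_trans (sub s a))//.
rewrite (le_trans (bellman_le vV bQ bQ' IHn s a))// exprS mulrA lerD2r.
exact: sup.
Qed.

Lemma bellman_fixpoint V : value_operator V ->
  exists Q, bounded_qfun Q /\ bellman V Q = Q.
Proof.
move=> vV; pose u n := iter n (bellman V) (fun _ _ => 0).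
have bu n : bounded_qfun (u n).
  elim: n => [|n IHn]; last exact: bellman_bounded.
  by apply/bounded_qfunP => a; exact: bounded_measurable_cst.
have [_ [C uC]] := bu 1%N.
have du n : forall s a, `|u n.+1 s a - u n s a| <= discount M ^+ n * C.
  elim: n => [|n IHn] s a; first by rewrite expr0 mul1r subr0.
  by rewrite exprS -mulrA; exact: (bellman_dist vV (bu n.+1) (bu n) IHn).
have [U [uU dU]] := @geometric_uniform_limit (S * A) R
  (fun n p => u n p.1 p.2) _ C discount_ge0M discount_lt1M (fun n p => du n p.1 p.2).
pose Q s a := U (s, a).
have dQ n s a : `|Q s a - u n s a| <= discount M ^+ n * (C / (1 - discount M)).
  exact: dU n (s, a).
have bQ : bounded_qfun Q.
  split=> [a|].
    apply: (@measurable_fun_cvg _ _ _ setT (fun n s => u n s a)) => [n|s _].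
      by case: (bu n).
    exact: uU (s, a).
  exists (discount M ^+ 0 * (C / (1 - discount M))) => s a.
  by have := dQ 0%N s a; rewrite /u/= subr0.
exists Q; split=> //; apply/funext => s; apply/funext => a.
apply/eqP; rewrite -subr_eq0 -normr_le0.
(* The defect of [Q] is split at [u n.+1]. Contraction bounds one half, the rate of convergence of
   [u] bounds the other by the same quantity, whence the factor 2. *)
apply: (@le_geometric_vanishing _ _ _ (discount M)
  (discount M * (C / (1 - discount M)) * 2)) => // n.
rewrite add0r -(subrKA (u n.+1 s a)) (le_trans (ler_normD _ _))//.
rewrite mulr_natr mulr2n mulrDr mulrCA lerD//.
  exact: (bellman_dist vV bQ (bu n) (dQ n)).
by rewrite distrC (le_trans (dQ n.+1 s a))// exprS mulrA.
Qed.

Lemma bellman_fixpoint_unique V Q Q' : value_operator V -> bounded_qfun Q ->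
  bounded_qfun Q' -> bellman V Q = Q -> bellman V Q' = Q' -> Q = Q'.
Proof.
move=> vV bQ bQ' QE QE'; apply/funext => s; apply/funext => a; apply/eqP.
by rewrite eq_le; apply/andP; split; apply: (bellman_comparison vV) => // {}s {}a;
  rewrite ?QE ?QE'.
Qed.

End Bellman.

(** * Soft evaluation operators and the log-sum-exp operator *)

Section SoftOperators.
Context {d : measure_display} {S : measurableType d} {A : finType}
  {R : realType}.
Variables (M : mdp S A R) (eta : R).
Hypotheses (A0 : (0 < #|A|)%N) (eta0 : 0 < eta).
Implicit Types (pi Q : S -> A -> R).

Definition soft_value pi Q (s : S) : R :=
  \sum_(b in A) pi s b * (Q s b - eta * ln (pi s b)).

Definition lse Q (s : S) : R := eta * ln (\sum_(b in A) expR (Q s b / eta)).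

Lemma policy_le1 pi s a : policy pi -> pi s a <= 1.
Proof.
move=> [_ pi0 pi1]; rewrite -(pi1 s) (bigD1 a)//= lerDl.
by apply: sumr_ge0 => b _; exact: pi0.
Qed.

Lemma bounded_policy pi a : policy pi -> bounded_measurable (fun s => pi s a).
Proof.
move=> hpi; have [mpi pi0 _] := hpi; split; first exact: mpi.
by exists 1 => s; rewrite ger0_norm// policy_le1.
Qed.

(** [ln (pi s a)] alone may be unbounded, but ln(1/x) <= 1/x - 1 gives 0 <= - x ln x <= 1 - x on (0,
    1]. *)
Lemma bounded_policy_ln pi a : policy pi ->
  bounded_measurable (fun s => pi s a * ln (pi s a)).
Proof.
move=> hpi; have [mpi pi0 _] := hpi; split.
  apply: measurable_funM; first exact: mpi.
  exact: (measurableT_comp (@measurable_ln R) (mpi a)).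
exists 1 => s; have := policy_le1 s a hpi; have := pi0 s a.
set x := pi s a; rewrite le_eqVlt => /predU1P[<-|x0 x1].
  by rewrite mul0r normr0 ler01.
have lnx0 : ln x <= 0 by exact: ln_le0.
rewrite ler0_norm; last exact: (mulr_ge0_le0 (ltW x0) lnx0).
have xV0 : 0 < x^-1 by rewrite invr_gt0.
have := ln_le_subr1 xV0; rewrite lnV ?posrE// -(ler_pM2l x0) mulrBr divff ?gt_eqF//.
by rewrite mulrN; lra.
Qed.

Lemma bounded_entropy pi : policy pi ->
  bounded_measurable (fun s => entropy (pi s)).
Proof.
move=> hpi; rewrite /entropy.
under eq_fun do rewrite -sumrN.
apply: bounded_measurable_sum => a.
under eq_fun do rewrite -mulN1r.
exact/bounded_measurableZ/bounded_policy_ln.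
Qed.

Lemma value_operator_soft_value pi : policy pi -> value_operator (soft_value pi).
Proof.
move=> hpi; have [_ pi0 pi1] := hpi; split=> [Q /bounded_qfunP bQ|Q Q' c QQ' s].
  apply: bounded_measurable_sum => a.
  under eq_fun do rewrite mulrBr mulrCA.
  apply: bounded_measurableB.
    by apply: bounded_measurableM => //; exact: bounded_policy.
  exact/bounded_measurableZ/bounded_policy_ln.
rewrite -[c]mul1r -(pi1 s) mulr_suml -big_split/=; apply: ler_sum => b _.
rewrite -mulrDr ler_wpM2l//; have := QQ' s b; lra.
Qed.

Lemma soft_value_le_lse pi Q s : policy pi -> soft_value pi Q s <= lse Q s.
Proof. by move=> [_ pi0 pi1]; apply: entropy_variational. Qed.

(** For this policy [Q - eta * ln pi] takes the same value [eta * L] at all actions, so averaging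
    does nothing. *)
Lemma soft_value_softmax Q s :
  soft_value (softmax (fun s a => Q s a / eta)) Q s = lse Q s.
Proof.
rewrite /soft_value /lse; set L := ln _.
rewrite (eq_bigr (fun b => softmax (fun s a => Q s a / eta) s b * (eta * L))).
  by rewrite -mulr_suml softmax_sum1// mul1r.
move=> b _; congr (_ * _); rewrite {1}/softmax ln_div ?posrE ?expR_gt0//.
  by rewrite expRK -/L; field; exact: lt0r_neq0.
exact: sum_expR_gt0.
Qed.

Lemma softmax_qfun_policy Q : bounded_qfun Q ->
  policy (softmax (fun s a => Q s a / eta)).
Proof.
move=> [mQ _]; apply: softmax_policy => // a.
by apply: measurable_funM => //; exact: measurable_cst.
Qed.

(** To compare [lse Q] with [lse Q'], the first is written as a soft value under the softmax of [Q];
    the same weights are then suboptimal for [Q']. *)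
Lemma value_operator_lse : value_operator lse.
Proof.
have le_lse Q Q' c : (forall s a, Q s a <= Q' s a + c) ->
    forall s, lse Q s <= lse Q' s + c.
  move=> QQ' s; rewrite -soft_value_softmax.
  set p := softmax _.
  have p0 b : 0 <= p s b by exact/ltW/softmax_gt0.
  have p1 : \sum_(b in A) p s b = 1 by exact: softmax_sum1.
  apply: (@le_trans _ _ (\sum_(b in A) p s b * (Q' s b - eta * ln (p s b)) + c)).
    rewrite -[c in leRHS]mul1r -p1 mulr_suml -big_split/=; apply: ler_sum => b _.
    by rewrite -mulrDr ler_wpM2l//; have := QQ' s b; lra.
  by rewrite lerD2r; exact: entropy_variational.
split=> // Q bQ; have [mQ [C QC]] := bQ; split.
  apply: measurable_funM => //.
  apply: (measurableT_comp (@measurable_ln R)); apply: measurable_sum_expR => a.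
  by apply: measurable_funM => //; exact: measurable_cst.
(* At the zero function [lse] does not depend on the state, so its value at [point] is valid
   everywhere; [Q] is within [C] of zero. *)
exists (`|lse (fun _ _ => 0) point| + C) => s.
have up := le_lse Q (fun _ _ => 0) C _ s.
have dn := le_lse (fun _ _ => 0) Q C _ s.
have {}up : lse Q s <= lse (fun _ _ => 0) point + C.
  by apply: up => t a; have /ler_normlP[] := QC t a; lra.
have {}dn : lse (fun _ _ => 0) point <= lse Q s + C.
  by apply: dn => t a; have /ler_normlP[] := QC t a; lra.
have := ler_norm (lse (fun _ _ => 0) point).
have := ler_norm (- lse (fun _ _ => 0) point); rewrite normrN.
by move=> h1 h2; rewrite ler_norml; apply/andP; split; lra.
Qed.

(** A bounded fixed point exists, so [xget] does not fall back on its default value. *)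
Lemma soft_qvalueP pi : policy pi ->
  bounded_qfun (soft_qvalue M eta pi) /\
  bellman M (soft_value pi) (soft_qvalue M eta pi) = soft_qvalue M eta pi.
Proof.
move=> hpi; rewrite /soft_qvalue; case: xgetP => [Q _ //|noQ].
have [Q QP] := bellman_fixpoint M (value_operator_soft_value hpi).
by case: (noQ Q).
Qed.

End SoftOperators.

(** * Values of controlled processes *)

(** The action set is a mere finite type, so measurability in a random action goes through the
    finite partition into the events where the action is [a]. *)
Lemma measurable_fun_finite_choice {d d' : measure_display}
    {T : measurableType d} {V : measurableType d'} {A : finType}
    (ac : T -> A) (F : A -> T -> V) :
  (forall a, measurable (ac @^-1` [set a])) ->
  (forall a, measurable_fun setT (F a)) ->
  measurable_fun setT (fun w => F (ac w) w).
Proof.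
move=> mac mF _ B mB; rewrite setTI.
rewrite (_ : _ @^-1` B = \bigcup_(a in setT) (ac @^-1` [set a] `&` F a @^-1` B)).
  apply: fin_bigcup_measurable => // a _; apply: measurableI => //.
  by rewrite -[X in measurable X]setTI; exact: mF.
by apply/seteqP; split=> w /= => [Bw|[a _ [<-]]//]; exists (ac w).
Qed.

(** * Replacing an event by its conditional probability *)

Section EventWeight.
Context {d d' : measure_display} {Omega : measurableType d}
  {S : measurableType d'} {R : realType}.
Variables (P : probability Omega R) (E : set Omega) (X : Omega -> S).
Hypotheses (mE : measurable E) (mX : measurable_fun setT X).

(** The measure of [B] given by P(X in B, E) is the mixture of the Dirac masses at [X w] with
    weights [q w]. *)
Lemma ge0_integral_event_weight (q : Omega -> R) (g : S -> \bar R) :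
  measurable_fun setT q -> (forall w, 0 <= q w) ->
  (forall B, measurable B ->
    P (X @^-1` B `&` E) = \int[P]_(w in X @^-1` B) (q w)%:E)%E ->
  (forall s, 0 <= g s)%E -> measurable_fun setT g ->
  (\int[pushforward (mrestr P mE) X]_s g s = \int[P]_w ((q w)%:E * g (X w)))%E.
Proof.
move=> mq q0 qE g0 mg.
rewrite (@ge0_integral_mixture _ _ _ _ _ P _
    (fun w => mscale (NngNum (q0 w)) \d_(X w))) => //.
- by apply: eq_integral => w _; rewrite ge0_integral_mscale//= integral_dirac// diracT mul1e.
- move=> U mU; rewrite /mscale/=.
  apply: emeasurable_funM; first exact/measurable_EFinP.
  apply/measurable_EFinP; rewrite (_ : (fun w => _) = \1_U \o X)//.
  exact: measurableT_comp.
- move=> U mU.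
  rewrite [LHS](_ : _ = P (X @^-1` U `&` E))// qE// [LHS]integral_mkcond.
  apply: eq_integral => w _; rewrite patchE.
  rewrite -[RHS]/((q w)%:E * \d_(X w) U)%E diracE.
  have -> : (w \in X @^-1` U) = (X w \in U) by apply/idP/idP; rewrite !inE.
  by case: ifP; rewrite ?mule1 ?mule0.
Qed.

(** The indicator of [E] and its conditional probability [p] are both weights for the same measure;
    [shift] evaluates the integral for any such weight [q] by an expression in which [q] no longer
    occurs. *)
Lemma Rintegral_event_weight (p : Omega -> R) (h : S -> R) :
  bounded_measurable p -> (forall w, 0 <= p w) ->
  (forall B, measurable B ->
    P (X @^-1` B `&` E) = \int[P]_(w in X @^-1` B) (p w)%:E)%E ->
  bounded_measurable h ->
  \int[P]_w (\1_E w * h (X w)) = \int[P]_w (p w * h (X w)).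
Proof.
move=> bp p0 pE bh; have [mh [C hC]] := bh.
have P1 : P setT = 1%E by exact: probability_setT.
have bX (f : S -> R) : bounded_measurable f -> bounded_measurable (f \o X).
  by move=> [mf [D fD]]; split; [exact: measurableT_comp|exists D => w; exact: fD].
have b1 : bounded_measurable (\1_E : Omega -> R).
  split; first exact: measurable_indic.
  by exists 1 => w; rewrite indicE; case: (w \in E); rewrite ?normr1 ?normr0.
have bh' : bounded_measurable (fun s => h s + C).
  by apply: bounded_measurableD => //; exact: bounded_measurable_cst.
have h'0 s : 0 <= h s + C by have /ler_normlP[] := hC s; lra.
have iE B : measurable B ->
    (P (X @^-1` B `&` E) = \int[P]_(w in X @^-1` B) (\1_E w)%:E)%E.
  move=> mB; have mXB : measurable (X @^-1` B).
    by rewrite -[Y in measurable Y]setTI; exact: mX.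
  by rewrite integral_indic// setIC.
have shift q : bounded_measurable q -> (forall w, 0 <= q w) ->
    (forall B, measurable B ->
      P (X @^-1` B `&` E) = \int[P]_(w in X @^-1` B) (q w)%:E)%E ->
    \int[P]_w (q w * h (X w)) =
    fine (\int[pushforward (mrestr P mE) X]_s (h s + C)%:E)%E - C * fine (P E).
  move=> bq q0 qE.
  rewrite (@ge0_integral_event_weight q (fun s => (h s + C)%:E) bq.1 q0 qE)//;
    last by apply/measurable_EFinP; case: bh'.
  have -> : fine (P E) = \int[P]_w q w.
    have := qE setT measurableT; rewrite preimage_setT setTI => ->//.
  rewrite -RintegralZ_prob//.
  under [X in fine X]eq_integral do rewrite -EFinM mulrDr [_ * C]mulrC.
  rewrite -/(Rintegral P setT _) RintegralD_prob ?addrK//.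
  - by apply: bounded_measurableM => //; exact: bX.
  - exact: bounded_measurableZ.
by rewrite (shift \1_E)// ?(shift p).
Qed.

End EventWeight.

(** * The expected return of a realization *)

Section ProcessValue.
Context {d : measure_display} {S : measurableType d} {A : finType}
  {R : realType}.
Variables (M : mdp S A R) (eta : R) (pi : S -> A -> R) (Q : S -> A -> R).
Hypotheses (hpi : policy pi) (bQ : bounded_qfun Q)
  (fixQ : bellman M (soft_value eta pi) Q = Q).
Context {d' : measure_display} {Omega : measurableType d'}.
Variables (P : probability Omega R) (st : nat -> Omega -> S)
  (ac : nat -> Omega -> A) (s0 : S).
Hypothesis process : controlled_process st ac M pi s0 P.

Let V := soft_value eta pi Q.
Let gain (s : S) (a : A) : R := reward M s a + eta * entropy (pi s).

Let P1 : P setT = 1%E. Proof. exact: probability_setT. Qed.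
Let mst n : measurable_fun setT (st n). Proof. by case: process. Qed.
Let mac n a : measurable (ac n @^-1` [set a]). Proof. by case: process. Qed.

Let bV : bounded_measurable V.
Proof. by have [+ _] := value_operator_soft_value eta hpi; apply. Qed.

Let bgain a : bounded_measurable (gain ^~ a).
Proof.
apply: bounded_measurableD; last exact/bounded_measurableZ/bounded_entropy.
split; first exact: reward_measurable.
by have [C rC] := reward_bounded M; exists C.
Qed.

Let cont (s : S) (a : A) : R := discount M * \int[trans M a s]_s' V s'.

Let bcont a : bounded_measurable (cont ^~ a).
Proof. exact/bounded_measurableZ/bounded_measurable_trans. Qed.

Let bst n (f : S -> R) : bounded_measurable f -> bounded_measurable (f \o st n).
Proof. by move=> [mf [D fD]]; split; [exact: measurableT_comp|exists D => w; exact: fD]. Qed.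

Let bac n (F : S -> A -> R) : (forall a, bounded_measurable (F ^~ a)) ->
  bounded_measurable (fun w => F (st n w) (ac n w)).
Proof.
move=> bF; have [_ [C FC]] := (bounded_qfunP F).2 bF; split; last by exists C.
apply: (@measurable_fun_finite_choice _ _ _ _ _ (ac n) (fun a w => F (st n w) a)) => // a.
by case: (bst n (bF a)).
Qed.

(** The average of - eta ln pi is eta times the entropy; being independent of the action, it can be
    moved into [gain] because the weights sum to 1. *)
Let VE s : V s = \sum_(a in A) pi s a * (gain s a + cont s a).
Proof.
have [_ _ pi1] := hpi.
rewrite /V /soft_value (eq_bigr (fun b =>
  pi s b * (reward M s b + cont s b) + - (eta * (pi s b * ln (pi s b))))).
  rewrite big_split/= sumrN -mulr_sumr -mulrN -/(entropy _).
  rewrite -[entropy _]mul1r -(pi1 s) mulr_suml mulr_sumr -big_split/=.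
  by apply: eq_bigr => b _; rewrite /gain; ring.
by move=> b _; rewrite -{1}fixQ /bellman -/V -/(cont s b); ring.
Qed.

(** The action law, on events of [st n], trades the weights [pi] for the indicators of the actions
    taken; the transition law, on the sure event, then trades the mean over the next state for
    [st n.+1]. *)
Lemma expected_step n :
  \int[P]_w V (st n w) = \int[P]_w gain (st n w) (ac n w) +
    discount M * \int[P]_w V (st n.+1 w).
Proof.
have [_ _ _ act_law next_law] := process.
have b1 a : bounded_measurable (\1_(ac n @^-1` [set a]) : Omega -> R).
  split; first exact: measurable_indic.
  by exists 1 => w; rewrite indicE; case: (_ \in _); rewrite ?normr1 ?normr0.
have bpi a : bounded_measurable (fun w => pi (st n w) a).
  exact: (bst n (bounded_policy a hpi)).
have bh a : bounded_measurable (fun s => gain s a + cont s a).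
  exact: bounded_measurableD.
transitivity (\int[P]_w (gain (st n w) (ac n w) + cont (st n w) (ac n w))).
  transitivity (\sum_(a in A)
      \int[P]_w (pi (st n w) a * (gain (st n w) a + cont (st n w) a))).
    rewrite -Rintegral_prob_sum//.
      by apply: eq_Rintegral => w _; exact: VE.
    by move=> a; apply: bounded_measurableM => //; exact: bst (bh a).
  transitivity (\sum_(a in A) \int[P]_w (\1_(ac n @^-1` [set a]) w *
      (gain (st n w) a + cont (st n w) a))).
    apply: eq_bigr => a _; apply/esym.
    apply: (Rintegral_event_weight (mac n a) (mst n) (bpi a) _ _ (bh a)).
      by case: hpi => _ + _ w; apply.
    move=> B mB; apply: act_law; apply: sub_sigma_algebra; left.
    by exists n => //; exists B.
  rewrite -Rintegral_prob_sum//.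
    apply: eq_Rintegral => w _; rewrite (bigD1 (ac n w))//= big1 ?addr0.
      by rewrite indicE mem_set// mul1r.
    by move=> a aw; rewrite indicE memNset ?mul0r//= => /esym/eqP; exact/negP.
  by move=> a; apply: bounded_measurableM => //; exact: bst (bh a).
rewrite RintegralD_prob//; last 2 first.
- exact: bac.
- exact: bac.
congr (_ + _).
have mnext U : measurable U ->
    measurable_fun setT (fun w => trans M (ac n w) (st n w) U).
  move=> mU; apply: (@measurable_fun_finite_choice _ _ _ _ _ (ac n)
    (fun a w => trans M a (st n w) U)) => // a.
  exact: (measurableT_comp (measurable_kernel (trans M a) U mU) (mst n)).
have next1 w : trans M (ac n w) (st n w) setT = 1%E by exact: prob_kernel.
rewrite (Rintegral_mixture (mst n.+1) mnext next1 P1)//.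
  have bnext := bounded_measurable_kernel mnext next1 bV.
  exact: (RintegralZ_prob (discount M) P1 bnext).
move=> U mU; have := next_law n U setT mU; rewrite setTI; apply.
exact: (@measurableT _ (g_sigma_algebraType _)).
Qed.

Let value_st0 : \int[P]_w V (st 0%N w) = V s0.
Proof.
have [_ _ init _ _] := process.
have VE0 : \int[\d_s0]_s V s = V s0.
  rewrite /Rintegral integral_dirac ?diracT ?mul1e//.
  by apply/measurable_EFinP; case: bV.
rewrite (@Rintegral_mixture _ _ _ _ _ _ _ (fun=> \d_s0))//.
- by rewrite VE0 Rintegral_prob_cst.
- by move=> y; exact: diracT.
- by move=> U mU; apply: (etrans (init U mU));
    rewrite integral_cst// -[LHS]mule1; congr (_ * _)%E; exact/esym/P1.
Qed.

(** Partial returns converge uniformly in the outcome at a geometric rate, so their expectations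
    converge too. *)
Lemma expected_return : ('E_P[regularized_return st ac M eta pi] = (V s0)%:E)%E.
Proof.
pose c := discount M.
have c0 : 0 <= c by exact: discount_ge0.
have c1 : c < 1 by exact: discount_lt1.
pose g n w := gain (st n w) (ac n w).
have [_ [G gG]] := (bounded_qfunP gain).2 bgain.
pose u n w := series (fun l => c ^+ l * g l w) n.
have bg n : bounded_measurable (g n) by exact: bac.
have bu n : bounded_measurable (u n).
  elim: n => [|n IHn]; rewrite /u/=.
    by under eq_fun do rewrite /series/= big_geq//; exact: bounded_measurable_cst.
  under eq_fun do rewrite seriesSr.
  by apply: bounded_measurableD => //; exact: bounded_measurableZ.
have du n w : `|u n.+1 w - u n w| <= c ^+ n * G.
  rewrite /u seriesSr addrC addKr normrM ger0_norm ?exprn_ge0//.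
  by rewrite ler_wpM2l ?exprn_ge0//; exact: gG.
have [U [uU dU]] := geometric_uniform_limit c0 c1 du.
have retE : regularized_return st ac M eta pi = U.
  by apply/funext => w; apply/cvg_lim => //; exact: uU.
have [mV [C VC]] := bV.
have bU : bounded_measurable U.
  split; first by apply: (@measurable_fun_cvg _ _ _ setT u) => // n; case: (bu n).
  exists (c ^+ 0 * (G / (1 - c))) => w.
  by have := dU 0%N w; rewrite /u /series/= big_geq// subr0.
have Eu n : \int[P]_w u n w = V s0 - c ^+ n * \int[P]_w V (st n w).
  elim: n => [|n IHn].
    rewrite expr0 mul1r value_st0 subrr /u.
    by under eq_Rintegral do rewrite /series/= big_geq//; exact: Rintegral_prob_cst.
  rewrite /u; under eq_Rintegral do rewrite seriesSr -/(u n _).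
  rewrite RintegralD_prob//; last exact: bounded_measurableZ.
  rewrite RintegralZ_prob// IHn (expected_step n) exprS /c /g; ring.
rewrite retE unlock -EFin_Rintegral_prob//; congr EFin; apply/eqP.
rewrite -subr_eq0 -normr_le0.
(* [G / (1 - c)] bounds the tail of the return, and [C] the expected value still to come after n
   steps, both up to [c ^+ n]. *)
apply: (@le_geometric_vanishing _ _ _ c (G / (1 - c) + C)) => // n.
rewrite add0r -(subrKA (\int[P]_w u n w)) (le_trans (ler_normD _ _))//.
rewrite mulrDr lerD//.
  have -> : \int[P]_w U w - \int[P]_w u n w = \int[P]_w (U w - u n w).
    rewrite [RHS](_ : _ = \int[P]_w (U w + (-1) * u n w)).
      rewrite RintegralD_prob//; last exact: bounded_measurableZ.
      by rewrite RintegralZ_prob// mulN1r.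
    by apply: eq_Rintegral => w _; rewrite mulN1r.
  apply: norm_Rintegral_prob => //.
  by apply: measurable_funB; [case: bU|case: (bu n)].
rewrite Eu addrC addrA addNr add0r normrN normrM ger0_norm ?exprn_ge0//.
rewrite ler_wpM2l ?exprn_ge0//; apply: norm_Rintegral_prob => //.
by case: (bst n bV).
Qed.

End ProcessValue.

(** * Construction of a realization *)

Section Realization.
Context {d : measure_display} {S : measurableType d} {A : finType}
  {R : realType}.
Variables (M : mdp S A R) (pi : S -> A -> R).
Hypothesis hpi : policy pi.
Variable a0 : A.
Local Open Scope ereal_scope.

Let pi_ge0 s a : (0 <= pi s a)%R. Proof. by case: hpi. Qed.
Let measurable_pi a : measurable_fun setT (pi ^~ a). Proof. by case: hpi. Qed.

(* Actions are encoded by their rank in [enum A], so that a step of the process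
   lives in the measurable space [S * nat]. *)
Definition decode (i : nat) : A := nth a0 (enum A) i.

Lemma sum_decode {V : nmodType} (F : A -> V) :
  (\sum_(i < #|A|) F (decode i) = \sum_(a in A) F a)%R.
Proof. by rewrite -[RHS]big_enum/= (big_nth a0) big_mkord -cardE. Qed.

Definition tag_law (i : nat) (m : {measure set S -> \bar R}) :
  set (S * nat) -> \bar R := pushforward m (pair^~ i).

Let tag_law0 i m : tag_law i m set0 = 0.
Proof. by rewrite /tag_law /pushforward preimage_set0 measure0. Qed.

Let tag_law_ge0 i m U : 0 <= tag_law i m U.
Proof. exact: measure_ge0. Qed.

Let tag_law_sigma_additive i m : semi_sigma_additive (tag_law i m).
Proof.
have mi := @pair2_measurable _ _ S nat i.
exact: (@measure_semi_sigma_additive _ _ _ (pushforward m (pair^~ i))).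
Qed.

HB.instance Definition _ i m := isMeasure.Build _ _ _ (tag_law i m)
  (tag_law0 i m) (tag_law_ge0 i m) (@tag_law_sigma_additive i m).

(** From a state, an action rank [i] is drawn by [pi], then the next state by the transition kernel;
    the new point is the next state tagged with [i]. *)
Definition step (x : S * nat) : {measure set (S * nat) -> \bar R} :=
  msum (fun i => mscale (NngNum (pi_ge0 x.1 (decode i)))
                        (tag_law i (trans M (decode i) x.1))) #|A|.

Lemma stepE x U : step x U =
  \sum_(i < #|A|) ((pi x.1 (decode i))%:E *
                   trans M (decode i) x.1 (pair^~ (i : nat) @^-1` U)).
Proof. by []. Qed.

Lemma integral_step x (f : S * nat -> \bar R) :
  (forall y, 0 <= f y) -> measurable_fun setT f ->
  \int[step x]_y f y = \sum_(i < #|A|) ((pi x.1 (decode i))%:E *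
    \int[trans M (decode i) x.1]_s f (s, i : nat)).
Proof.
move=> f0 mf; rewrite /step ge0_integral_measure_sum//.
apply: eq_bigr => i _; rewrite ge0_integral_mscale//=; congr (_ * _).
by rewrite [LHS](ge0_integral_pushforward (@pair2_measurable _ _ S nat i)).
Qed.

Let measurable_step U : measurable U -> measurable_fun setT (step ^~ U).
Proof.
move=> mU; rewrite (_ : step ^~ U = fun x => \sum_(i < #|A|)
    ((pi x.1 (decode i))%:E *
     trans M (decode i) x.1 (pair^~ (i : nat) @^-1` U))); last first.
  by apply/funext => x; exact: stepE.
apply: emeasurable_sum => i; apply: emeasurable_funM.
  apply/measurable_EFinP.
  exact: (measurableT_comp (measurable_pi (decode i)) measurable_fst).
have mUi : measurable (pair^~ (i : nat) @^-1` U : set S).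
  by rewrite -[X in measurable X]setTI; exact: pair2_measurable.
exact: (measurableT_comp (measurable_kernel (trans M (decode i)) _ mUi)
                         measurable_fst).
Qed.

HB.instance Definition _ := isKernel.Build _ _ _ _ _ step measurable_step.

Let step_prob x : step x setT = 1.
Proof.
rewrite stepE; under eq_bigr do rewrite preimage_setT prob_kernel mule1.
by rewrite sumEFin (sum_decode (pi x.1)); case: hpi => _ _ ->.
Qed.

HB.instance Definition _ := Kernel_isProbability.Build _ _ _ _ _ step step_prob.

Variable s0 : S.
(** Coordinate n holds the action a_n and the state s_(n+1), whence the different indexing of
    [states] and [actions]. The rank 0 in [x0] is a placeholder: [step] reads only the state. *)
Let x0 : S * nat := (s0, 0%N).
Let states n (w : trajectory (S * nat)%type) : S := (tcons x0 w n).1.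
Let actions n (w : trajectory (S * nat)%type) : A := decode (w n).2.

Let measurable_states n : measurable_fun setT (states n).
Proof.
apply: (measurableT_comp measurable_fst).
by case: n => [|n]; [exact: measurable_cst|exact: measurable_coordinate].
Qed.

Let measurable_actions n a : measurable (actions n @^-1` [set a]).
Proof.
rewrite (_ : _ @^-1` _ = (fun w : trajectory (S * nat)%type => (w n).2) @^-1`
  (decode @^-1` [set a]))// -[X in measurable X]setTI.
exact: (measurableT_comp measurable_snd (measurable_coordinate n)).
Qed.

Let history_cylinder n H : history states actions n n H -> cylinder _ n H.
Proof.
apply: smallest_sub; first exact: cylinder_sigma_algebra.
move=> _ [[i im [B mB ->]]|[i im [a ->]]]; split.
- by rewrite -[X in measurable X]setTI; exact: measurable_states.
- move=> w w' ww'; rewrite /preimage /mkset /states.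
  by case: i im => [//|i] im /=; rewrite ww'.
- exact: measurable_actions.
- by move=> w w' ww'; rewrite /preimage /mkset /actions ww'.
Qed.

(** Such a history knows a_n but not s_(n+1), though both sit in coordinate n; being a cylinder of
    order [n.+1] would not express this. *)
Let history_next n H : history states actions n n.+1 H -> measurable H /\
  forall w w', (forall i, (i < n)%N -> w i = w' i) /\
    actions n w = actions n w' -> H w = H w'.
Proof.
move: H; apply: smallest_sub.
  exact: (invariant_sigma_algebra (fun w w' =>
    (forall i, (i < n)%N -> w i = w' i) /\ actions n w = actions n w')).
move=> _ [[i im [B mB ->]]|[i im [a ->]]]; split.
- by rewrite -[X in measurable X]setTI; exact: measurable_states.
- move=> w w' [ww' _]; rewrite /preimage /mkset /states.
  by case: i im => [//|i] im /=; rewrite ww'.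
- exact: measurable_actions.
- move=> w w' [ww' aww']; rewrite /preimage /mkset.
  move: im; rewrite ltnS leq_eqVlt => /predU1P[->|im]; first by rewrite aww'.
  by rewrite /actions ww'.
Qed.

Let states_update n w y : states n (update w n y) = states n w.
Proof.
by rewrite /states; case: n => [//|n] /=; rewrite /update ltn_eqF.
Qed.

Let actions_update n w y : actions n (update w n y) = decode y.2.
Proof. by rewrite /actions /update eqxx. Qed.

Let measurable_update1 w n :
  measurable_fun setT (fun y => update w n y : trajectory (S * nat)%type).
Proof.
exact: (measurableT_comp (measurable_update n) (pair1_measurable w)).
Qed.

Let states_depends n : depends_on n (states n).
Proof. by move=> w w' ww'; rewrite /states; case: n ww' => [//|n] /= ->. Qed.

Let eq_indic (U : set (trajectory (S * nat)%type)) w w' :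
  U w = U w' -> \1_U w = \1_U w' :> R.
Proof.
by move=> UE; rewrite !indicE; congr (_%:R); congr (nat_of_bool _);
  apply/idP/idP; rewrite !inE UE.
Qed.

Let markov_indic n (U : set (trajectory (S * nat)%type)) :
  measurable U -> depends_on n.+1 U ->
  \int[trajectory_law step x0]_w (\1_U w)%:E = \int[trajectory_law step x0]_w
    \int[step (tcons x0 w n)]_y (\1_U (update w n y))%:E.
Proof.
move=> mU depU; apply: (@ionescu_tulcea_markov _ _ _ step n x0
  (fun w => (\1_U w)%:E)).
- by move=> w; rewrite lee_fin.
- by apply/measurable_EFinP; exact: measurable_indic.
- by move=> w w' /depU UE; rewrite (eq_indic UE).
Qed.

Let integral_step_indic x w n (U : set (trajectory (S * nat)%type)) :
  measurable U -> \int[step x]_y (\1_U (update w n y))%:E =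
  \sum_(i < #|A|) ((pi x.1 (decode i))%:E *
    \int[trans M (decode i) x.1]_s (\1_U (update w n (s, i : nat)))%:E).
Proof.
move=> mU; apply: (@integral_step x (fun y => (\1_U (update w n y))%:E)).
- by move=> y; rewrite lee_fin.
- have mI : measurable_fun setT (\1_U : trajectory (S * nat)%type -> R).
    exact: measurable_indic.
  by apply/measurable_EFinP; exact: (measurableT_comp mI (measurable_update1 w n)).
Qed.

Let action_step n a H : history states actions n n H ->
  trajectory_law step x0 (H `&` actions n @^-1` [set a]) =
  \int[trajectory_law step x0]_(w in H) (pi (states n w) a)%:E.
Proof.
move=> /history_cylinder[mH Hn].
set E := H `&` _.
have mE : measurable E by exact: measurableI.
rewrite -[in LHS](setIT E) -integral_indic// [RHS]integral_mkcond.
have depE : depends_on n.+1 E.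
  move=> w w' ww'; rewrite /E /setI /preimage /mkset /actions ww'//.
  by rewrite (Hn w w')// => i /ltnW; exact: ww'.
(* Resampling coordinate n leaves [H] unchanged and draws the action from [pi (states n w)], so only
   the action [a] contributes. *)
rewrite (markov_indic mE depE).
apply: eq_integral => w _; rewrite integral_step_indic//.
have indE s i : \1_E (update w n (s, i)) = ((w \in H) && (decode i == a))%:R :> R.
  rewrite indicE; congr (_%:R); congr (nat_of_bool _).
  have HE : H (update w n (s, i)) = H w.
    by apply: Hn => j jn; rewrite /update ltn_eqF.
  apply/idP/andP; rewrite !inE /E /setI /preimage /mkset actions_update HE.
    by move=> [? /eqP].
  by move=> [? /eqP].
transitivity (\sum_(i < #|A|) ((pi (states n w) (decode i))%:E *
    (((w \in H) && (decode i == a))%:R)%:E)).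
  apply: eq_bigr => i _; congr (_ * _).
  under eq_integral do rewrite indE.
  by rewrite integral_cst// prob_kernel mule1.
rewrite (sum_decode (fun b => (pi (states n w) b)%:E *
  (((w \in H) && (b == a))%:R)%:E)).
rewrite (bigD1 a)//= big1 ?adde0; last first.
  by move=> b /negbTE ->; rewrite andbF mule0.
by rewrite eqxx andbT patchE; case: ifP; rewrite ?mule1 ?mule0.
Qed.

(** [H] involves the action stored in coordinate n, so conditioning on the coordinates below n does
    not fix it. Coordinate n is resampled on both sides instead, and the results are compared for
    each action drawn. *)
Let transition_step n B H : measurable B -> history states actions n n.+1 H ->
  trajectory_law step x0 (H `&` states n.+1 @^-1` B) =
  \int[trajectory_law step x0]_(w in H) trans M (actions n w) (states n w) B.
Proof.
move=> mB /history_next[mH Hn]; set E := H `&` _.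
have mE : measurable E.
  apply: measurableI => //.
  by rewrite -[X in measurable X]setTI; exact: measurable_states.
pose g w := (\1_H w)%:E * trans M (actions n w) (states n w) B.
have mg : measurable_fun setT g.
  apply: emeasurable_funM; first by apply/measurable_EFinP; exact: measurable_indic.
  apply: (@measurable_fun_finite_choice _ _ _ _ _ (actions n)
    (fun a w => trans M a (states n w) B)) => // a.
  exact: (measurableT_comp (measurable_kernel (trans M a) B mB)).
have g0 w : 0 <= g w by rewrite mule_ge0// lee_fin.
have -> : \int[trajectory_law step x0]_(w in H)
      trans M (actions n w) (states n w) B =
    \int[trajectory_law step x0]_w g w.
  rewrite [LHS]integral_mkcond; apply: eq_integral => w _.
  by rewrite patchE /g indicE; case: ifP; rewrite ?mul1e ?mul0e.
have Hnext w w' : (forall i, (i < n.+1)%N -> w i = w' i) -> H w = H w'.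
  by move=> ww'; apply: Hn; split; [move=> i /ltnW; exact: ww'|rewrite /actions ww'].
rewrite -[in LHS](setIT E) -integral_indic//.
have depE : depends_on n.+1 E.
  move=> w w' ww'; rewrite /E /setI /preimage /mkset /states /= ww'//.
  by rewrite (Hnext _ _ ww').
have depg : depends_on n.+1 g.
  move=> w w' ww'; rewrite /g /actions ww'// (@states_depends n w w').
    by rewrite (eq_indic (Hnext _ _ ww')).
  by move=> i /ltnW; exact: ww'.
rewrite (markov_indic mE depE).
rewrite [RHS](ionescu_tulcea_markov step x0 g0 mg depg).
apply: eq_integral => w _; rewrite integral_step_indic//.
rewrite [RHS]integral_step//; last first.
  exact: (measurableT_comp mg (measurable_update1 w n)).
apply: eq_bigr => i _; congr (_ * _).
(* [H] sees the action but not the new state, which can be frozen at [point], so that the indicator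
   of [H] leaves the integral. *)
have HE s : H (update w n (s, i : nat)) = H (update w n (point, i : nat)).
  apply: Hn; split; last by rewrite !actions_update.
  by move=> j jn; rewrite /update ltn_eqF.
pose h : R := \1_H (update w n (point, i : nat)).
have hE s : \1_H (update w n (s, i : nat)) = h.
  exact: (eq_indic (HE s)).
transitivity (\int[trans M (decode i) (states n w)]_s (h%:E * (\1_B s)%:E)).
  apply: eq_integral => s _; rewrite -EFinM -(hE s) !indicE -natrM mulnb.
  congr (_%:R%:E); congr (nat_of_bool _).
  apply/idP/andP; rewrite !inE /E /setI /preimage /mkset /states /=.
    by rewrite /update eqxx.
  by rewrite {3}/update eqxx.
rewrite ge0_integralZl//; last 2 first.
- by apply/measurable_EFinP; exact: measurable_indic.
- by rewrite lee_fin /h indicE.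
rewrite integral_indic// setIT.
transitivity (\int[trans M (decode i) (states n w)]_s
    (h%:E * trans M (decode i) (states n w) B)).
  by rewrite integral_cst// prob_kernel mule1.
apply: eq_integral => s _.
by rewrite /g hE actions_update states_update.
Qed.

Lemma controlled_process_exists :
  exists (d' : measure_display) (Omega : measurableType d')
    (P : probability Omega R) (st : nat -> Omega -> S) (ac : nat -> Omega -> A),
    controlled_process st ac M pi s0 P.
Proof.
exists _, (trajectory (S * nat)%type), (trajectory_law step x0), states, actions.
split=> [//|//|B mB|n a H HH|n B H mB HH].
- rewrite diracE; case: (boolP (s0 \in B)) => [/set_mem s0B|/negP s0B].
    rewrite (_ : _ @^-1` B = setT); last by apply/seteqP; split.
    by rewrite probability_setT.
  rewrite (_ : _ @^-1` B = set0) ?measure0//.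
  by apply/seteqP; split=> // w Bw; case: s0B; exact: mem_set.
- exact: action_step.
- exact: transition_step.
Qed.

End Realization.

(** * Optimality and policy iteration *)

Lemma geometric_cvg {R : realType} (u : nat -> R) (l c C : R) :
  0 <= c -> c < 1 -> (forall n, `|l - u n| <= c ^+ n * C) ->
  u n @[n --> \oo] --> l.
Proof.
move=> c0 c1 uC.
have c_cvg0 : c ^+ n * C @[n --> \oo] --> 0.
  by rewrite -[X in _ --> X](mul0r C); apply: cvgMl; apply: cvg_expr; rewrite ger0_norm.
apply: (@squeeze_cvgr _ _ _ _ (fun n => l - c ^+ n * C) (fun n => l + c ^+ n * C)).
- by apply: nearW => n; have := uC n; rewrite ler_distlC.
- by rewrite -[X in _ --> X]subr0; apply: cvgB => //; exact: cvg_cst.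
- by rewrite -[X in _ --> X]addr0; apply: cvgD => //; exact: cvg_cst.
Qed.

Lemma cvg_softmax {d : measure_display} {S : measurableType d} {A : finType}
    {R : realType}
    (f : nat -> S -> A -> R) (g : S -> A -> R) s a : (0 < #|A|)%N ->
  (forall b, f n s b @[n --> \oo] --> g s b) ->
  softmax (f n) s a @[n --> \oo] --> softmax g s a.
Proof.
move=> A0 fg.
have efg b : expR (f n s b) @[n --> \oo] --> expR (g s b).
  by apply: (cvg_comp _ _ (fg b)); exact: continuous_expR.
apply: cvgM => //; apply: cvgV; first by rewrite gt_eqF ?sum_expR_gt0.
by apply: cvg_big => //; exact: add_continuous.
Qed.

Section Optimality.
Context {d : measure_display} {S : measurableType d} {A : finType}
  {R : realType}.
Variables (M : mdp S A R) (eta : R).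
Hypotheses (A0 : (0 < #|A|)%N) (eta0 : 0 < eta).
Implicit Types (pi Q : S -> A -> R).

Lemma regularized_valueE pi s : policy pi ->
  regularized_value M eta pi s = soft_value eta pi (soft_qvalue M eta pi) s.
Proof.
move=> hpi; have [bQ QE] := soft_qvalueP M eta hpi.
have [a0 _] := card_gt0P A0.
have [dO [W [P [st [ac process]]]]] := controlled_process_exists M hpi a0 s.
apply: xget_unique.
  exists dO, W, P, st, ac; split=> //.
  exact: (expected_return hpi bQ QE process).
move=> v [d1 [W1 [P1 [st1 [ac1 [process1 v1]]]]]].
by have := expected_return hpi bQ QE process1; rewrite v1 => -[].
Qed.

Variable Qs : S -> A -> R.
Hypotheses (bQs : bounded_qfun Qs) (QsE : bellman M (lse eta) Qs = Qs).

Let QsE_at s a : bellman M (lse eta) Qs s a = Qs s a.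
Proof. by rewrite QsE. Qed.

Let pis := softmax (fun s a => Qs s a / eta).

(** By Gibbs' inequality [Qs] is a supersolution for the operator of [pi]. *)
Lemma soft_qvalue_le pi s a : policy pi -> soft_qvalue M eta pi s a <= Qs s a.
Proof.
move=> hpi; have [bQ QE] := soft_qvalueP M eta hpi.
have vpi := value_operator_soft_value eta hpi.
apply: (bellman_comparison (M := M) vpi bQ bQs) => {}s {}a; first by rewrite QE.
rewrite -[leRHS]QsE_at.
apply: (bellman_mono M vpi (value_operator_lse A0 eta0) bQs) => {}s.
exact: soft_value_le_lse.
Qed.

Lemma soft_qvalue_optimal : soft_qvalue M eta pis = Qs.
Proof.
have hpis : policy pis by exact: softmax_qfun_policy.
have [bQ QE] := soft_qvalueP M eta hpis.
apply: (bellman_fixpoint_unique (value_operator_soft_value eta hpis) bQ bQs QE).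
rewrite -[RHS]QsE; apply/funext => s; apply/funext => a; rewrite /bellman.
by congr (_ + _ * _); apply: eq_Rintegral => s' _; exact: soft_value_softmax.
Qed.

(** The supremum is a maximum, attained by the one policy [pis] at all states. *)
Lemma opt_valueE s : opt_value M eta s = lse eta Qs s.
Proof.
have hpis : policy pis by exact: softmax_qfun_policy.
have ub : ubound [set regularized_value M eta pi s | pi in policy] (lse eta Qs s).
  move=> _ [pi hpi <-]; rewrite regularized_valueE//.
  apply: (le_trans (soft_value_le_lse A0 eta0 _ s hpi)).
  have [_ le_lse] := value_operator_lse (S := S) A0 eta0.
  rewrite -[leRHS]addr0; apply: le_lse => {}s a; rewrite addr0.
  exact: soft_qvalue_le.
have attained : [set regularized_value M eta pi s | pi in policy] (lse eta Qs s).
  exists pis => //; rewrite regularized_valueE// soft_qvalue_optimal.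
  exact: soft_value_softmax.
apply/eqP; rewrite eq_le; apply/andP; split.
  by apply: ge_sup => //; exists (lse eta Qs s).
by apply: ub_le_sup => //; exists (lse eta Qs s).
Qed.

Lemma opt_qvalueE : opt_qvalue M eta = Qs.
Proof.
rewrite -[RHS]QsE; apply/funext => s; apply/funext => a; congr (_ + _ * _).
by apply: eq_Rintegral => s' _; exact: opt_valueE.
Qed.

(* The improved policy is greedy for [Q]: its operator agrees with the optimality
   operator at [Q], so that the first iterate dominates [Q]. *)
Lemma soft_improvement_ge pi s a : policy pi ->
  bellman M (lse eta) (soft_qvalue M eta pi) s a <=
  soft_qvalue M eta (softmax (fun s a => soft_qvalue M eta pi s a / eta)) s a.
Proof.
move=> hpi; have [bQ QE] := soft_qvalueP M eta hpi.
set Q := soft_qvalue M eta pi in bQ QE *; set pi' := softmax _.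
have hpi' : policy pi' by exact: softmax_qfun_policy.
have [bQ' QE'] := soft_qvalueP M eta hpi'.
have vpi' := value_operator_soft_value eta hpi'.
have vlse := value_operator_lse (S := S) A0 eta0.
have greedy : bellman M (soft_value eta pi') Q = bellman M (lse eta) Q.
  apply/funext => {}s; apply/funext => {}a; congr (_ + _ * _).
  by apply: eq_Rintegral => s' _; exact: soft_value_softmax.
have Qle t b : Q t b <= bellman M (lse eta) Q t b + 0.
  rewrite addr0 -{1}QE.
  apply: (bellman_mono M (value_operator_soft_value eta hpi) vlse bQ) => {}t.
  exact: soft_value_le_lse.
have bU := bellman_bounded M vlse bQ.
apply: (bellman_comparison (M := M) vpi' bU bQ') => {}s {}a; last by rewrite QE'.
(* With T the optimality operator and T' that of [pi']: T Q = T' Q <= T' (T Q), since Q <= T Q and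
   T' is monotone. So T Q is a subsolution for [pi']. *)
rewrite -{1}greedy -[leRHS]addr0 -[X in _ + X](mulr0 (discount M)).
exact: (bellman_le M vpi' bQ bU Qle).
Qed.

Lemma soft_policy_iteration_policy (pi : nat -> S -> A -> R) k :
  policy (pi 0%N) -> soft_policy_iteration M eta pi -> policy (pi k) /\
  pi k.+1 = softmax (fun s a => soft_qvalue M eta (pi k) s a / eta).
Proof.
move=> pi0 hpi.
have piS n : policy (pi n) ->
    pi n.+1 = softmax (fun s a => soft_qvalue M eta (pi n) s a / eta).
  move=> hpin; have [[mQ _] _] := soft_qvalueP M eta hpin.
  exact: (soft_improvementE A0 mQ (hpi n)).
have policy_pi n : policy (pi n).
  elim: n => // n IHn; rewrite piS//; apply: softmax_qfun_policy => //.
  by have [] := soft_qvalueP M eta IHn.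
by split=> //; exact: piS.
Qed.

Lemma soft_policy_iteration_rate (pi : nat -> S -> A -> R) :
  policy (pi 0%N) -> soft_policy_iteration M eta pi ->
  exists C, forall k s a,
    `|Qs s a - soft_qvalue M eta (pi k) s a| <= discount M ^+ k * C.
Proof.
move=> pi0 hpi.
have piP k := soft_policy_iteration_policy k pi0 hpi.
have vlse := value_operator_lse (S := S) A0 eta0.
have [[_ [C QsC]] [_ [D QD]]] := (bQs, (soft_qvalueP M eta pi0).1).
(* [C + D] bounds the initial gap, since [C] bounds [Qs] and [D] the soft action-value function of
   the initial policy. *)
suff rate k : forall s a,
    Qs s a <= soft_qvalue M eta (pi k) s a + discount M ^+ k * (C + D).
  exists (C + D) => k s a; rewrite ger0_norm.
    by rewrite lerBlDl; exact: rate.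
  by rewrite subr_ge0; apply: soft_qvalue_le; case: (piP k).
elim: k => [|k IHk] s a.
  have /ler_normlP[_ QsCs] := QsC s a; have /ler_normlP[QDs _] := QD s a.
  by rewrite expr0 mul1r; lra.
have [hpik piSE] := piP k; rewrite piSE.
have [bQ _] := soft_qvalueP M eta hpik.
rewrite -[leLHS]QsE_at exprS -mulrA.
apply: (le_trans (bellman_le M vlse bQs bQ IHk s a)).
by rewrite lerD2r; exact: soft_improvement_ge.
Qed.

End Optimality.

Theorem theorem2 (d : measure_display) (S : measurableType d) (A : finType)
    (R : realType) (M : mdp S A R) (eta : R) (pi : nat -> S -> A -> R)
    (hA : (0 < #|A|)%N) (heta : 0 < eta) (hpi0 : policy (pi 0%N))
    (hpi : soft_policy_iteration M eta pi) :
  exists pistar : S -> A -> R,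
    [/\ policy pistar,
        forall s a, (pi k s a) @[k --> \oo] --> pistar s a,
        forall s a, (soft_qvalue M eta (pi k) s a) @[k --> \oo] -->
                    soft_qvalue M eta pistar s a,
        forall s a, soft_qvalue M eta pistar s a = opt_qvalue M eta s a &
        forall s a, pistar s a = opt_policy M eta s a].
Proof.
have [Qs [bQs QsE]] := bellman_fixpoint M (value_operator_lse (S := S) hA heta).
have qvalue_opt := soft_qvalue_optimal hA heta bQs QsE.
have [C rate] := soft_policy_iteration_rate hA heta bQs QsE hpi0 hpi.
have Q_cvg s a : soft_qvalue M eta (pi k) s a @[k --> \oo] --> Qs s a.
  apply: geometric_cvg (discount_ge0 M) (discount_lt1 M) _ => k.
  exact: rate.
exists (softmax (fun s a => Qs s a / eta)); split.
- exact: softmax_qfun_policy.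
- move=> s a; rewrite -cvg_shiftS.
  under eq_fun do rewrite (soft_policy_iteration_policy hA _ hpi0 hpi).2.
  by apply: cvg_softmax => // b; apply: cvgMl; exact: Q_cvg.
- by rewrite qvalue_opt.
- by move=> s a; rewrite qvalue_opt (opt_qvalueE hA heta bQs QsE).
- by move=> s a; rewrite /opt_policy (opt_qvalueE hA heta bQs QsE).
Qed.
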